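(* Let $\Xi=(\xi_n)_{n\ge0}$ be a time-homogeneous Markov chain on a state space $\mathbb X\subseteq\mathbb R_+$. (i) Suppose that (N) and $(\mathrm T_{\alpha,\beta,c})$ hold. Then $\Xi$ is recurrent if $$\limsup_{x\to\infty}\big(x^{\alpha-1}\mu(x)\big)<c\pi|\csc(\pi\alpha)|,$$ and $\Xi$ is transient if $$\liminf_{x\to\infty}\big(x^{\alpha-1}\mu(x)\big)>c\pi|\csc(\pi\alpha)|.$$ (ii) $\Xi$ is positive recurrent if there exist $\alpha\in(1,2)$ and $\gamma<\alpha-1$ such that $\limsup_{x\to\infty}\mathbb E_x[|\theta|^\alpha]<\infty$ and $\limsup_{x\to\infty}(x^\gamma\mu(x))<0$.
   Context: $\mathbb X$ is an infinite, unbounded, measurable subset of $\mathbb R_+$ (a standard Borel space). $\mathbb P_x,\mathbb E_x$ denote probability and expectation for the chain started at $\xi_0=x$. The increment is $\theta:=\xi_1-\xi_0$; for $y\in\mathbb R$, $y_+:=y\mathbf 1\{y\ge0\}$ and $y_-:=-y\mathbf 1\{y<0\}$. The drift is $\mu(x):=\mathbb E_x[\theta]$. For $a\ge0$, $\tau_a:=\min\{n\ge0:\xi_n\le a\}$. Recurrence/transience: $\Xi$ is transient if $\xi_n\to\infty$ a.s.; recurrent if $\liminf_n\xi_n\le r_0$ a.s. for some deterministic $r_0\in\mathbb R_+$; positive recurrent if $\mathbb E_x[\tau_a]<\infty$ for all sufficiently large $a$ and all $x$; null recurrent if recurrent and $\mathbb E_x[\tau_a]=\infty$ for all sufficiently large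 $a$ and all $x>a$. Condition (N): $\limsup_{n\to\infty}\xi_n=+\infty$ a.s. Condition $(\mathrm T_{\alpha,\beta,c})$: there exist constants $\alpha\in(1,2)$, $\beta>\alpha$, $c>0$ and $x_0\in\mathbb R_+$ such that $\lim_{y\to\infty}\sup_{x\ge x_0}|y^\alpha\mathbb P_x[\theta_+>y]-c|=0$ and $\sup_{x\ge x_0}\mathbb E_x[\theta_-^\beta]<\infty$. *)

(* Defs.v *)
From HB Require Import structures.
From mathcomp Require Import all_boot all_order all_algebra.
From mathcomp Require Import all_classical all_reals all_analysis.
From mathcomp Require Import measurable_realfun.
Set Implicit Arguments. Unset Strict Implicit. Unset Printing Implicit Defensive.
Import Order.TTheory GRing.Theory Num.Theory.
Import numFieldNormedType.Exports.
Local Open Scope classical_set_scope.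
Local Open Scope ring_scope.

Definition pospart {R : realType} (y : R) : R := if 0 <= y then y else 0.
Definition negpart {R : realType} (y : R) : R := if y < 0 then - y else 0.

Section chain.
Context {R : realType} {d : measure_display} {Om : measurableType d}.
Variables (X : set R) (P : R -> probability Om R) (xi : nat -> Om -> R).

Definition theta (w : Om) : R := xi 1 w - xi 0 w.

Definition markov_chain : Prop :=
  [/\ forall n, measurable_fun setT (xi n),
      forall x n, X x -> P x [set w | X (xi n w)] = 1%E,
      forall x, X x -> P x [set w | xi 0 w = x] = 1%E,
      forall B, measurable B -> measurable_fun X ((fun y => P y (xi 1 @^-1` B)) : R -> \bar R) &
      forall x, X x -> forall (n : nat) (A : nat -> set R) (B : set R),
        (forall i, measurable (A i)) -> measurable B ->
        P x ([set w | forall i, (i <= n)%N -> A i (xi i w)] `&` (xi n.+1 @^-1` B))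
        = (\int[P x]_(w in [set w | forall i, (i <= n)%N -> A i (xi i w)])
              P (xi n w) (xi 1 @^-1` B))%E ].

Definition drift (x : R) : \bar R := (\int[P x]_w (theta w)%:E)%E.

(* tau_a := min {n >= 0 : xi_n <= a}  (= +oo if the set is empty) *)
Definition hitting_time (a : R) (w : Om) : \bar R :=
  ereal_inf [set (n%:R)%:E | n in [set n : nat | xi n w <= a]].

Definition transient : Prop :=
  forall x, X x -> {ae P x, forall w, xi n w @[n --> \oo] --> +oo}.

Definition recurrent : Prop :=
  exists r0 : R, 0 <= r0 /\
    forall x, X x -> {ae P x, forall w, (limn_einf (fun n => (xi n w)%:E) <= r0%:E)%E}.

Definition positive_recurrent : Prop :=
  exists a0 : R, forall a, a0 <= a -> forall x, X x ->
    (\int[P x]_w hitting_time a w < +oo)%E.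

Definition condN : Prop :=
  forall x, X x -> {ae P x, forall w, limn_esup (fun n => (xi n w)%:E) = +oo%E}.

Definition condT (alpha beta c : R) : Prop :=
  [/\ 1 < alpha < 2, alpha < beta, 0 < c &
    exists x0 : R, 0 <= x0 /\
      ((fun y => ereal_sup [set (`| y `^ alpha *
                     fine (P x [set w | pospart (theta w) > y]) - c |)%:E
                   | x in [set x | X x /\ (x0 <= x)%R]])
         @ +oo --> 0%E)
      /\ (ereal_sup [set \int[P x]_w ((negpart (theta w)) `^ beta)%:E
                    | x in [set x | X x /\ (x0 <= x)%R]] < +oo)%E].

End chain.

(* Main.v *)
(** The chain is compared with Lyapunov functions: ln (1 + x) for recurrence,
    (1 + x)^-nu with small nu > 0 for transience, x^(1 + gamma) for positive
    recurrence.  With phi t = t - ln (1 + t), both cases of (i) reduce to the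
    asymptotics, uniform in the starting point, of E phi (theta_+ / (1 + x)).
    Writing V = theta_+ / (1 + x), the layer-cake formula along y = e^z gives
    E phi V = int_R e^(2z) / (1 + e^z) P (V > e^z) dz, so a tail c y^-alpha
    produces c (1 + x)^-alpha int_R e^((2 - alpha) z) / (1 + e^z) dz.  By Euler's
    reflection formula the last integral is pi / |sin (pi alpha)|: it equals
    B s + B (1 - s) for s = 2 - alpha, where B s = int_{z <= 0} e^(sz) / (1 + e^z) dz
    is determined by B s + B (s + 1) = 1 / s and monotonicity, and a triplication
    formula makes Herglotz' argument available.  Only finite-horizon supermartingale
    inequalities are needed, because (N) forces the chain above every level. *)

Require Import Defs.
From HB Require Import structures.
From mathcomp Require Import all_boot all_order all_algebra.
From mathcomp Require Import all_classical all_reals all_analysis.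
From mathcomp Require Import measurable_realfun.
From mathcomp Require Import ring lra.
Import Order.TTheory GRing.Theory Num.Theory.
Import numFieldNormedType.Exports.
Local Open Scope classical_set_scope.
Local Open Scope ring_scope.

(** * Supermartingale inequalities for the chain *)

Import HBNNSimple.

(** The threshold comes from a first-order comparison. With t = theta / (1 + x), the increment of
    the logarithm is t - phi t for t >= 0 and at most t otherwise. Its drift is thus at most mu(x) /
    (1 + x) - E phi (theta_+ / (1 + x)); both terms have order x^-alpha, and their coefficients are
    compared. For (1 + x)^-nu the upward defect is at most nu (1 + nu) phi t, so the same comparison
    returns up to a factor 1 + nu, which a small nu makes harmless. Relative to (1 + x)^-nu,
    downward jumps cost order x^(nu - b) with b = min(beta, 2) > alpha, which is negligible for
    small nu.

    Two obstacles shape the formal side. The law [P y] is meaningful only for y in [X], and the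
    Markov property is given for cylinders and one further step, so estimates on paths become sums
    over cylinders. The drift is an integral not known in advance to be finite, so theta is split
    into theta_+ and theta_-, each with its own nonnegative integral, and inequalities are arranged
    without subtraction before integrating. *)

Lemma integral_nnsfun_comp (d : measure_display) (T : measurableType d) (R : realType)
    (mu : measure T R) (D : set T) (Z : T -> R) (g : {nnsfun R >-> R}) :
  measurable D -> measurable_fun setT Z ->
  (\int[mu]_(w in D) (g (Z w))%:E =
   \sum_(r \in range g) r%:E * mu (D `&` Z @^-1` (g @^-1` [set r])))%E.
Proof.
move=> mD mZ.
have mA r : measurable (Z @^-1` (g @^-1` [set r])).
  by rewrite -[X in measurable X]setTI; exact: mZ.
have mI r : measurable_fun D (fun w => (\1_(g @^-1` [set r]) (Z w) : R)).
  apply: measurable_funTS.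
  have mB : measurable (g @^-1` [set r]) by [].
  exact: (measurableT_comp (measurable_indic mB) mZ).
under eq_integral => w _ do rewrite fimfunE -fsumEFin//.
rewrite ge0_integral_fsum//=.
- apply: eq_fsbigr => r rg.
  have r0 : 0 <= r by move: rg; rewrite inE => -[x _ <-].
  under eq_integral => w _ do rewrite EFinM.
  rewrite ge0_integralZl_EFin//=.
  + congr (_ * _)%E; rewrite setIC -integral_indic//.
  + exact/measurable_EFinP.
- move=> r; apply/measurable_EFinP; exact: measurable_funM.
- move=> r w _; rewrite EFinM.
  exact: nnfun_muleindic_ge0.
Qed.

Definition cylinder {R : realType} {d : measure_display} {Om : measurableType d}
    (xi : nat -> Om -> R) (A : nat -> set R) (n : nat) : set Om :=
  [set w | forall i, (i <= n)%N -> A i (xi i w)].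

Section chain.
Context {R : realType} {d : measure_display} {Om : measurableType d}.
Context {X : set R} {P : R -> probability Om R} {xi : nat -> Om -> R}.
Hypothesis mX : measurable X.
Hypothesis chain : markov_chain X P xi.

Let mxi n : measurable_fun setT (xi n).
Proof. by case: chain. Qed.

Lemma measurable_preimage_chain (B : set R) n :
  measurable B -> measurable (xi n @^-1` B).
Proof. by move=> mB; rewrite -[X in measurable X]setTI; exact: mxi. Qed.

Lemma cylinderS A n : cylinder xi A n.+1 = cylinder xi A n `&` xi n.+1 @^-1` A n.+1.
Proof.
apply/seteqP; split=> [w Aw|w [Aw Aw1] i].
  by split=> [i ni|]; apply: Aw => //; exact: leqW.
by rewrite leq_eqVlt => /predU1P[->//|]; exact: Aw.
Qed.

Lemma measurable_cylinder A n : (forall i, measurable (A i)) ->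
  measurable (cylinder xi A n).
Proof.
move=> mA; elim: n => [|n ih].
  rewrite (_ : cylinder xi A 0 = xi 0 @^-1` A 0%N); first exact: measurable_preimage_chain.
  by apply/seteqP; split=> [w|w + i]; [exact|rewrite leqn0 => + /eqP ->].
by rewrite cylinderS; apply: measurableI => //; exact: measurable_preimage_chain.
Qed.

Lemma chain_in_ae x n : X x -> \forall w \ae P x, X (xi n w).
Proof.
case: chain => _ inX _ _ _ Xx.
exists (~` (xi n @^-1` X)); split.
- by apply: measurableC; exact: measurable_preimage_chain.
- rewrite probability_setC ?inX ?subee//; exact: measurable_preimage_chain.
- by move=> w /= + Xw; apply.
Qed.

Lemma chain_start_ae x : X x -> \forall w \ae P x, xi 0 w = x.
Proof.
case: chain => _ _ st _ _ Xx.
have mx : measurable [set w | xi 0 w = x].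
  exact: (@measurable_preimage_chain [set x] 0%N (measurable_set1 x)).
exists (~` [set w | xi 0 w = x]); split.
- exact: measurableC.
- by rewrite probability_setC ?st ?subee.
- by move=> w.
Qed.

(** The Markov property is assumed for events on [xi n.+1] only. Summing over the finitely many
    values of a simple function carries it to simple functions, monotone convergence to [f]. The
    surplus [delta] serves positive recurrence. *)
Lemma markov_step (x delta : R) (f : R -> R) (A : nat -> set R) n :
  X x -> 0 <= delta -> (forall y, 0 <= f y) -> measurable_fun setT f ->
  (forall i, measurable (A i)) ->
  (forall y, X y -> A n y ->
     (\int[P y]_w (f (xi 1 w))%:E + delta%:E <= (f y)%:E)%E) ->
  (\int[P x]_(w in cylinder xi A n) (f (xi n.+1 w))%:E
     + delta%:E * P x (cylinder xi A n)
   <= \int[P x]_(w in cylinder xi A n) (f (xi n w))%:E)%E.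
Proof.
move=> Xx d0 f0 mf mA hf.
(* [P y] is only meaningful for [y] in [X], so the cylinder is first cut down
   to [xi n] in [X], which changes it by a null set. *)
case: (chain) => _ inX _ mker mkv.
have mH := @measurable_cylinder A n mA.
pose A' i := if i == n then A i `&` X else A i.
have mA' i : measurable (A' i) by rewrite /A'; case: ifP => _; [exact: measurableI|].
have mH' := @measurable_cylinder A' n mA'.
have H'E : cylinder xi A' n = cylinder xi A n `&` xi n @^-1` X.
  apply/seteqP; split=> [w Aw|w [Aw Xw] i ni]; last first.
    by rewrite /A'; case: eqP => [->|_]; [split=> //|]; exact: Aw.
  have := Aw n (leqnn _); rewrite /A' eqxx => -[_ Xw]; split=> // i ni.
  by have := Aw i ni; rewrite /A'; case: ifP => // _ [].
pose N := ~` (xi n @^-1` X).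
have mN : measurable N by apply: measurableC; exact: measurable_preimage_chain.
have PN : P x N = 0%E.
  by rewrite probability_setC ?inX ?subee//; exact: measurable_preimage_chain.
have mfx k : measurable_fun setT (fun w => (f (xi k w))%:E).
  by apply/measurable_EFinP; exact: measurableT_comp.
have HN (F : Om -> \bar R) : (forall w, (0 <= F w)%E) -> measurable_fun setT F ->
    (\int[P x]_(w in cylinder xi A n) F w = \int[P x]_(w in cylinder xi A' n) F w)%E.
  move=> F0 mF; rewrite (@ge0_negligible_integral _ _ _ (P x) _ N)//.
  - by rewrite H'E /N setDE setCK.
  - exact: measurable_funTS.
have PH : P x (cylinder xi A n) = P x (cylinder xi A' n).
  rewrite -[LHS]mul1e -[RHS]mul1e -!(integral_cst (P x)) //.
  by apply: HN.
rewrite PH !HN//; last 2 first.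
  by move=> w; rewrite lee_fin.
  by move=> w; rewrite lee_fin.
have mfE : measurable_fun setT (EFin \o f) by exact/measurable_EFinP.
pose g := nnsfun_approx measurableT mfE.
have gf y : (g k y)%:E @[k --> \oo] --> (f y)%:E.
  by apply: (@cvg_nnsfun_approx _ _ _ _ measurableT _ mfE) => // z _; rewrite lee_fin.
have ndg y : {homo (fun k => (g k y)%:E) : m n / (m <= n)%N >-> (m <= n)%E}.
  by move=> k l kl; rewrite lee_fin; apply/lefP; exact: nd_nnsfun_approx.
have gle k y : ((g k y)%:E <= (f y)%:E)%E.
  have <- := cvg_lim (@ereal_hausdorff R) (gf y).
  rewrite (cvg_lim _ (ereal_nondecreasing_cvgn (ndg y)))//.
  by apply: ereal_sup_ubound; exists k.
have mxE k z : measurable_fun setT (fun w => (g k (xi z w))%:E).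
  by apply/measurable_EFinP; exact: measurableT_comp.
have dfin : (delta%:E * P x (cylinder xi A' n))%E \is a fin_num.
  by rewrite fin_numM// fin_num_measure.
have XA' w : cylinder xi A' n w -> X (xi n w) /\ A n (xi n w).
  by move=> /(_ n (leqnn _)); rewrite /A' eqxx => -[].
have bound k : (\int[P x]_(w in cylinder xi A' n) (g k (xi n.+1 w))%:E
     + delta%:E * P x (cylinder xi A' n)
   <= \int[P x]_(w in cylinder xi A' n) (f (xi n w))%:E)%E.
  rewrite integral_nnsfun_comp//.
  pose B r := xi 1 @^-1` (g k @^-1` [set r]).
  have mP r : measurable_fun (cylinder xi A' n) (fun w => P (xi n w) (B r)).
    apply: (measurable_comp mX _ (mker _ _)) => //.
    - by move=> _ [w Aw <-]; case: (XA' w Aw).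
    - exact: measurable_funTS.
  (* Exchanging sum and integral asks for nonnegative summands at every index [r], also outside
     [range (g k)]; [Num.max 0 r] provides this and equals [r] on the range. *)
  have t0 r w : (0 <= (Num.max 0 r)%:E * P (xi n w) (B r))%E.
    by rewrite mule_ge0// lee_fin le_max lexx.
  have r0 r : r \in range (g k) -> 0 <= r by rewrite inE => -[y _ <-].
  have -> : (\sum_(r \in range (g k)) r%:E * P x (cylinder xi A' n `&`
        xi n.+1 @^-1` (g k @^-1` [set r])) =
      \int[P x]_(w in cylinder xi A' n) \sum_(r \in range (g k)) (Num.max 0 r)%:E * P (xi n w) (B r))%E.
    rewrite ge0_integral_fsum//.
    - apply: eq_fsbigr => r rg; rewrite mkv// max_r ?r0//.
      by rewrite ge0_integralZl_EFin// r0.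
    - by move=> r; apply: emeasurable_funM.
  rewrite -(integral_cst _ mH') -ge0_integralD//.
  - apply: ge0_le_integral => //.
    + by move=> w _; apply: adde_ge0; [exact: fsume_ge0|rewrite /= lee_fin].
    + apply: emeasurable_funD => //; apply: emeasurable_fsum => // r.
      exact: emeasurable_funM.
    + exact: measurable_funTS.
    + move=> w Aw; have [Xw Anw] := XA' w Aw.
      apply: le_trans (hf _ Xw Anw); rewrite leeD2r//.
      (* For the chain started at [xi n w] the same sum is the expectation of [g k (xi 1)], to which
         [hf] applies. *)
      rewrite (_ : \sum_(r \in _) _ =
         \int[P (xi n w)]_w (g k (xi 1 w))%:E)%E; last first.
        rewrite integral_nnsfun_comp//; apply: eq_fsbigr => r rg.
        by rewrite setTI max_r// r0.
      apply: ge0_le_integral => // w' _.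
      by rewrite lee_fin.
  - by move=> w _; exact: fsume_ge0.
  - apply: emeasurable_fsum => // r.
    exact: emeasurable_funM.
rewrite -leeBrDr//.
have cvgf w : (g k (xi n.+1 w))%:E @[k --> \oo] --> (f (xi n.+1 w))%:E by exact: gf.
rewrite (_ : \int[P x]_(w in cylinder xi A' n) (f (xi n.+1 w))%:E =
   limn (fun k => \int[P x]_(w in cylinder xi A' n) (g k (xi n.+1 w))%:E))%E; last first.
  rewrite -monotone_convergence//.
  - by apply: eq_integral => w _; rewrite (cvg_lim _ (cvgf w)).
  - by move=> k; apply: measurable_funTS.
  - by move=> k w _; rewrite lee_fin.
apply: lime_le.
  apply: ereal_nondecreasing_is_cvgn => k l kl; apply: ge0_le_integral => //.
  - by move=> w _; rewrite lee_fin.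
  - by apply: measurable_funTS.
  - by apply: measurable_funTS.
  - by move=> w _; exact: ndg.
by apply: nearW => k; rewrite leeBrDr.
Qed.

(* Optional stopping without stopping times: the exits into [E] are charged
   against the initial value of [f], one time step after the other. *)
Lemma markov_sum (x lam delta : R) (f : R -> R) (A : nat -> set R) (E : set R) m N :
  X x -> 0 <= lam -> 0 <= delta -> (forall y, 0 <= f y) -> measurable_fun setT f ->
  (forall i, measurable (A i)) -> measurable E ->
  (forall i, (m < i)%N -> A i `&` E = set0) ->
  (forall y, E y -> lam <= f y) ->
  (forall n y, (m <= n)%N -> X y -> A n y ->
     (\int[P y]_w (f (xi 1 w))%:E + delta%:E <= (f y)%:E)%E) ->
  (\int[P x]_(w in cylinder xi A (m + N)) (f (xi (m + N) w))%:E
     + \sum_(0 <= i < N) (lam%:E * P x (cylinder xi A (m + i) `&` xi (m + i).+1 @^-1` E)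
                         + delta%:E * P x (cylinder xi A (m + i)))
   <= \int[P x]_(w in cylinder xi A m) (f (xi m w))%:E)%E.
Proof.
move=> Xx l0 d0 f0 mf mA mE AE fE hf.
have mfx k : measurable_fun setT (fun w => (f (xi k w))%:E).
  by apply/measurable_EFinP; exact: measurableT_comp.
elim: N => [|N ih]; first by rewrite big_nil adde0 addn0.
apply: le_trans ih; rewrite big_nat_recr//= addeCA addeC leeD2r//.
have := @markov_step x delta f A (m + N) Xx d0 f0 mf mA (fun y => hf _ y (leq_addr _ _)).
apply: le_trans; rewrite addeA leeD2r// addnS.
set H := cylinder xi A (m + N).
have mH : measurable H by exact: measurable_cylinder.
have mHE : measurable (H `&` xi (m + N).+1 @^-1` E).
  by apply: measurableI => //; exact: measurable_preimage_chain.
have mHA : measurable (cylinder xi A (m + N).+1) by exact: measurable_cylinder.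
(* The paths still in [A] and those entering [E] at time [(m + N).+1] are disjoint parts of [H], so
   [f] may be integrated over both. *)
have disj : [disjoint cylinder xi A (m + N).+1 & H `&` xi (m + N).+1 @^-1` E].
  rewrite cylinderS; apply/disj_setPS => w [[_ Aw] [_ Ew]].
  have : (A (m + N).+1 `&` E) (xi (m + N).+1 w) by [].
  by rewrite AE// ltnS leq_addr.
apply: (@le_trans _ _ (\int[P x]_(w in cylinder xi A (m + N).+1 `|`
    (H `&` xi (m + N).+1 @^-1` E)) (f (xi (m + N).+1 w))%:E)%E).
  rewrite ge0_integral_setU//=; last 2 first.
  - exact: measurable_funTS.
  - by move=> w _; rewrite lee_fin.
  rewrite leeD2l// -integral_cst//; apply: ge0_le_integral => //.
  - exact: measurable_funTS.
  - by move=> w [_ Ew]; rewrite /= lee_fin; exact: fE.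
apply: ge0_subset_integral => //.
- exact: measurableU.
- exact: measurable_funTS.
- by move=> w _; rewrite lee_fin.
- by move=> w [|[]//]; rewrite cylinderS => -[].
Qed.

(** The integral over the surviving paths is nonnegative and is dropped before [N] goes to infinity.
    With [delta = 0] this bounds the probability of ever entering [E], with [lam = 0] the expected
    time spent in [A]. *)
Lemma markov_series (x lam delta : R) (f : R -> R) (A : nat -> set R) (E : set R) m :
  X x -> 0 <= lam -> 0 <= delta -> (forall y, 0 <= f y) -> measurable_fun setT f ->
  (forall i, measurable (A i)) -> measurable E ->
  (forall i, (m < i)%N -> A i `&` E = set0) ->
  (forall y, E y -> lam <= f y) ->
  (forall n y, (m <= n)%N -> X y -> A n y ->
     (\int[P y]_w (f (xi 1 w))%:E + delta%:E <= (f y)%:E)%E) ->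
  (\sum_(0 <= i <oo) (lam%:E * P x (cylinder xi A (m + i) `&` xi (m + i).+1 @^-1` E)
                         + delta%:E * P x (cylinder xi A (m + i)))
   <= \int[P x]_(w in cylinder xi A m) (f (xi m w))%:E)%E.
Proof.
move=> Xx l0 d0 f0 mf mA mE AE fE hf.
apply: lime_le.
  by apply: is_cvg_nneseries => i _ _; rewrite adde_ge0// mule_ge0// lee_fin.
apply: nearW => N; apply: le_trans (@markov_sum x lam delta f A E m N _ _ _ _ _ _ _ _ _ _) => //.
by rewrite leeDr//; apply: integral_ge0 => w _; rewrite lee_fin.
Qed.

Lemma le_measure_ae x (A B : set Om) : measurable A -> measurable B ->
  (\forall w \ae P x, A w -> B w) -> (P x A <= P x B)%E.
Proof.
move=> mA mB [Z [mZ Z0 AB]].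
rewrite -[leRHS]adde0 -[X in (_ <= _ + X)%E]Z0.
apply: le_trans (measureU2 _ mB mZ).
apply: le_measure; rewrite ?inE//; first exact: measurableU.
move=> w Aw; have [Bw|nBw] := pselect (B w); [by left|right].
by apply: AB => /(_ Aw).
Qed.

Lemma limn_esup_pinfty (u : nat -> R) : limn_esup (fun n => (u n)%:E) = +oo%E ->
  forall y m, exists2 n, (m <= n)%N & y < u n.
Proof.
rewrite limn_esup_lim => uoo y m.
have : (y%:E < esups (fun n => (u n)%:E) m)%E.
  apply: (@lt_le_trans _ _ +oo%E); first exact: ltry.
  rewrite -uoo; have ni := @nonincreasing_esups R (fun n => (u n)%:E).
  rewrite (cvg_lim _ (ereal_nonincreasing_cvgn ni))//.
  by apply: ereal_inf_lbound; exists m.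
by move=> /ereal_sup_gt[_ [n /= mn <-]]; rewrite lte_fin; exists n.
Qed.

Lemma limn_einf_gtP (u : nat -> R) a : (a%:E < limn_einf (fun n => (u n)%:E))%E ->
  exists m, forall n, (m <= n)%N -> a < u n.
Proof.
rewrite limn_einf_lim.
have nd := @nondecreasing_einfs R (fun n => (u n)%:E).
rewrite (cvg_lim _ (ereal_nondecreasing_cvgn nd))// => /ereal_sup_gt[_ [m _ <-]] am.
exists m => n mn; rewrite -lte_fin; apply: (lt_le_trans am).
by apply: ereal_inf_lbound; exists n.
Qed.
End chain.

(** * Foster-Lyapunov criteria *)

Section criteria.
Context {R : realType} {d : measure_display} {Om : measurableType d}.
Context {X : set R} {P : R -> probability Om R} {xi : nat -> Om -> R}.
Hypothesis mX : measurable X.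
Hypothesis X0 : forall x, X x -> 0 <= x.
Hypothesis chain : markov_chain X P xi.

(** A path of [S m K] has value at most [f K] at time [m] and pays at least [f y] when it passes
    [y], so [S m K] has probability at most [f K / f y]. As [f] is unbounded, it is null, and
    countably many pairs [m], [K] exhaust the paths with liminf above [a]. *)
Lemma recurrent_criterion (f : R -> R) (a : R) : 0 <= a -> condN X P xi ->
  (forall y, 0 <= f y) -> measurable_fun setT f ->
  (forall y z, 0 <= y -> y <= z -> f y <= f z) ->
  (forall M, exists2 y, 0 <= y & M < f y) ->
  (forall y, X y -> a < y -> (\int[P y]_w (f (xi 1 w))%:E <= (f y)%:E)%E) ->
  recurrent X P xi.
Proof.
move=> a0 hN f0 mf fmono funb hsup; exists a; split=> // x Xx.
(* The chain stays above [a] from time [m] on, but exceeds every level [y] first. *)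
pose S m K := xi m @^-1` `]a, K%:R] `&` \bigcap_i (xi (m + i) @^-1` `]a, +oo[).
have mS m K : measurable (S m K).
  apply: measurableI; first exact: (measurable_preimage_chain chain).
  by apply: bigcap_measurableType => i _; exact: (measurable_preimage_chain chain).
have S0 m K : P x (S m K) = 0%E.
  have key y : K%:R < y -> ((f y)%:E * P x (S m K) <= (f K%:R)%:E)%E.
    move=> Ky.
    pose A i : set R := if (i < m)%N then setT
                        else if i == m then `]a, K%:R]%classic else `]a, y]%classic.
    have mA i : measurable (A i) by rewrite /A; case: ifP => // _; case: ifP.
    pose G i := cylinder xi A (m + i) `&` xi (m + i).+1 @^-1` `]y, +oo[.
    have mG i : measurable (G i).
      by apply: measurableI; [exact: (measurable_cylinder chain)|exact: (measurable_preimage_chain chain)].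
    have cover : \forall w \ae P x, S m K w -> (\bigcup_i G i) w.
      have := hN x Xx; apply: filterS => w /limn_esup_pinfty/(_ y m.+1) hlim.
      move=> [/= Sm SK].
      have ex : exists n, (m < n)%N && (y < xi n w).
        by have [n mn yn] := hlim; exists n; rewrite mn.
      case: (ex_minnP ex) => n /andP[mn yn] nmin.
      (* [G i] describes an exit at time [m + i + 1], hence the index [n - m.+1]. *)
      exists (n - m.+1)%N => //; rewrite /G.
      have nE : (m + (n - m.+1)).+1 = n by rewrite -addSn subnKC.
      split; last by rewrite nE /= in_itv/= yn.
      move=> i; rewrite -ltnS nE => ni; rewrite /A.
      case: ltnP => // mi; case: eqP => [->//|/eqP im].
      have {}mi : (m < i)%N by rewrite ltn_neqAle eq_sym im.
      have := SK (i - m)%N I; rewrite /= subnKC ?(ltnW mi)// !in_itv/= andbT => ->/=.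
      by rewrite leNgt; apply/negP => yi; move: ni; rewrite ltnNge (nmin i) ?mi.
    have PS : (P x (S m K) <= P x (\bigcup_i G i))%E.
      by apply: le_measure_ae => //; exact: bigcup_measurable.
    have PG : (P x (\bigcup_i G i) <= \sum_(0 <= i <oo) P x (G i))%E.
      by apply: measure_sigma_subadditive => //; exact: bigcup_measurable.
    apply: (@le_trans _ _ (\sum_(0 <= i <oo) ((f y)%:E * P x (G i)
        + 0%:E * P x (cylinder xi A (m + i))))%E).
      under eq_eseriesr do rewrite mul0e adde0.
      rewrite nneseriesZl//; apply: lee_wpmul2l; first by rewrite lee_fin.
      exact: le_trans PS PG.
    apply: le_trans (@markov_series _ _ _ _ _ _ mX chain x (f y) 0 f A `]y, +oo[ m
        _ _ _ _ _ _ _ _ _ _) _ => //.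
    - move=> i mi; rewrite /A ltnNge (ltnW mi)/= gtn_eqF//.
      apply/seteqP; split=> // z [] /=; rewrite !in_itv/= andbT => /andP[_ zy].
      by rewrite ltNge zy.
    - move=> z; rewrite /= in_itv/= andbT => yz; apply: fmono; last exact: ltW.
      by rewrite (le_trans _ (ltW Ky)).
    - move=> n z mn Xz Az; rewrite adde0; apply: hsup => //.
      by move: Az; rewrite /A ltnNge mn/=; case: eqP => _ /=; rewrite in_itv/= => /andP[].
    have mH : measurable (cylinder xi A m) by exact: (measurable_cylinder chain).
    apply: (@le_trans _ _ (\int[P x]_(w in cylinder xi A m) (cst (f K%:R)%:E w))%E).
      apply: ge0_le_integral => //.
      - by move=> w _; rewrite lee_fin.
      - apply: measurable_funTS; apply/measurable_EFinP; apply: measurableT_comp => //.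
        by case: chain.
      - move=> w /(_ m (leqnn _)); rewrite /A ltnn eqxx /= in_itv/= => /andP[aw wK].
        by rewrite lee_fin; apply: fmono => //; rewrite (le_trans a0)// ltW.
    rewrite integral_cst// -[leRHS]mule1; apply: lee_wpmul2l; first by rewrite lee_fin.
    exact: probability_le1.
  apply/eqP; rewrite eq_le measure_ge0 andbT leNgt; apply/negP => p0.
  have pfin : P x (S m K) \is a fin_num by exact: fin_num_measure.
  move: p0 key; rewrite -(fineK pfin); set p := fine _; rewrite lte_fin => p0 key.
  (* The first bound contradicts [key]; the second only forces [K < y], by monotonicity of [f]. *)
  have [y y0] := funb (Num.max (f K%:R / p) (f (K.+1%:R))).
  rewrite gt_max => /andP[fy fyK].
  have Ky : K%:R < y.
    rewrite ltNge; apply/negP => yK; move: fyK; rewrite ltNge => /negP; apply.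
    by apply: fmono => //; rewrite (le_trans yK)// ler_nat.
  by have := key y Ky; rewrite -EFinM lee_fin leNgt -ltr_pdivrMr// fy.
have aeS : \forall w \ae P x, forall m K, ~ S m K w.
  apply: ae_foralln => m; apply: ae_foralln => K.
  by exists (S m K); split; [|exact: S0|move=> w /= /contrapT].
apply: filterS aeS => w nS; rewrite leNgt; apply/negP => /limn_einf_gtP[m wm].
apply: (nS m (Num.truncn (xi m w)).+1); split=> /=; last first.
  by move=> i _ /=; rewrite in_itv/= andbT wm// leq_addr.
by rewrite in_itv/= wm// ltW// truncnS_gt.
Qed.

(** [bad k] is the event of infinitely many visits below [k]. Summing the hitting bound over [m]
    costs nothing, because the first passage times above [y] give disjoint events of total mass at
    most 1. Then [y] is chosen with [f y] as small as desired. *)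
Lemma transient_criterion (f : R -> R) (a : R) : condN X P xi ->
  (forall y, 0 <= f y) -> measurable_fun setT f ->
  (forall y, 0 <= y -> 0 < f y) ->
  (forall y z, 0 <= y -> y <= z -> f z <= f y) ->
  (forall e, 0 < e -> exists2 y, 0 <= y & f y < e) ->
  (forall y, X y -> a < y -> (\int[P y]_w (f (xi 1 w))%:E <= (f y)%:E)%E) ->
  transient X P xi.
Proof.
move=> hN f0 mf fpos fmono finf hsup x Xx.
(* Split according to the first time [m] above a high level [y]: afterwards
   [0, k] is hit with probability at most [f y / f k]. *)
pose bad k := \bigcap_m \bigcup_i (xi (m + i) @^-1` `]-oo, (k%:R : R)]).
have mbad k : measurable (bad k).
  apply: bigcap_measurableType => m _; apply: bigcup_measurable => i _.
  exact: (measurable_preimage_chain chain).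
have bad0 k : a <= k%:R -> P x (bad k) = 0%E.
  move=> ak; have k0 : 0 <= k%:R :> R by [].
  have key y : k%:R < y -> ((f k%:R)%:E * P x (bad k) <= (f y)%:E)%E.
    move=> ky.
    (* The cylinder prescribes first passage above [y] at time [m], then staying above [k]. *)
    pose A m i : set R := if (i < m)%N then `]-oo, y]%classic
                        else if i == m then `]y, +oo[%classic else `]k%:R, +oo[%classic.
    have mA m i : measurable (A m i) by rewrite /A; case: ifP => // _; case: ifP.
    (* Intersecting with [X] keeps [E] in the half-line where [f] is monotone; the chain is almost
       surely in [X], so no path of interest is lost. *)
    pose E := X `&` `]-oo, k%:R].
    have mE : measurable E by exact: measurableI.
    pose G m i := cylinder xi (A m) (m + i) `&` xi (m + i).+1 @^-1` E.
    have mG m i : measurable (G m i).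
      by apply: measurableI; [exact: (measurable_cylinder chain)|exact: (measurable_preimage_chain chain)].
    have mGm m : measurable (\bigcup_i G m i) by exact: bigcup_measurable.
    have inX : \forall w \ae P x, forall n, X (xi n w).
      by apply: ae_foralln => n; exact: (chain_in_ae mX chain).
    have cover : \forall w \ae P x, bad k w -> (\bigcup_m \bigcup_i G m i) w.
      apply: filterS2 inX (hN x Xx) => w wX /limn_esup_pinfty/(_ y 0%N) hlim wbad.
      have ex : exists n, (y < xi n w) by have [n _ yn] := hlim; exists n.
      case: (ex_minnP ex) => m ym mmin; exists m => //.
      have ex2 : exists n, (m < n)%N && (xi n w <= k%:R).
        have [i _ /=] := wbad m.+1 I; rewrite in_itv/= => wk.
        by exists (m.+1 + i)%N; rewrite wk andbT addSn ltnS leq_addr.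
      case: (ex_minnP ex2) => n /andP[mn nk] nmin.
      exists (n - m.+1)%N => //; rewrite /G.
      have nE : (m + (n - m.+1)).+1 = n by rewrite -addSn subnKC.
      split; last by rewrite nE /=; split => //=; rewrite in_itv.
      move=> i; rewrite -ltnS nE => ni; rewrite /A.
      case: ltnP => [im|mi]/=.
        by rewrite in_itv/= leNgt; apply/negP => /mmin; rewrite leqNgt im.
      case: eqP => [->/=|/eqP im]; first by rewrite in_itv/= ym.
      have {}mi : (m < i)%N by rewrite ltn_neqAle eq_sym im.
      rewrite /= in_itv/= andbT ltNge; apply/negP => ik.
      by move: ni; rewrite ltnNge nmin// mi.
    have PS : (P x (bad k) <= P x (\bigcup_m \bigcup_i G m i))%E.
      by apply: le_measure_ae => //; exact: bigcup_measurable.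
    have PG : (P x (\bigcup_m \bigcup_i G m i) <=
        \sum_(0 <= m <oo) \sum_(0 <= i <oo) P x (G m i))%E.
      apply: (@le_trans _ _ (\sum_(0 <= m <oo) P x (\bigcup_i G m i))%E).
        by apply: measure_sigma_subadditive => //; exact: bigcup_measurable.
      apply: lee_nneseries => // m _.
      by apply: measure_sigma_subadditive => //; exact: bigcup_measurable.
    pose C m := cylinder xi (A m) m.
    have mC m : measurable (C m) by exact: (measurable_cylinder chain).
    have step m : ((f k%:R)%:E * (\sum_(0 <= i <oo) P x (G m i)) <= (f y)%:E * P x (C m))%E.
      apply: (@le_trans _ _ (\sum_(0 <= i <oo) ((f k%:R)%:E * P x (G m i)
          + 0%:E * P x (cylinder xi (A m) (m + i))))%E).
        under [leRHS]eq_eseriesr do rewrite mul0e adde0.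
        by rewrite nneseriesZl.
      apply: le_trans (@markov_series _ _ _ _ _ _ mX chain x (f k%:R) 0 f (A m) E m
          _ _ _ _ _ _ _ _ _ _) _ => //.
      - move=> i mi; rewrite /A ltnNge (ltnW mi)/= gtn_eqF//.
        apply/seteqP; split=> // z [] /=; rewrite !in_itv/= andbT => zk [_] /=.
        by rewrite in_itv/= leNgt zk.
      - by move=> z [Xz] /=; rewrite in_itv/= => zk; apply: fmono => //; exact: X0.
      - move=> n z mn Xz Az; rewrite adde0; apply: hsup => //.
        apply: (le_lt_trans ak); move: Az; rewrite /A ltnNge mn/=.
        by case: eqP => _ /=; rewrite in_itv/= andbT// => yz; exact: lt_trans yz.
      apply: (@le_trans _ _ (\int[P x]_(w in C m) (cst (f y)%:E w))%E).
        apply: ge0_le_integral => //; first exact: mC.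
        - by move=> w _; rewrite lee_fin.
        - apply: measurable_funTS; apply/measurable_EFinP; apply: measurableT_comp => //.
          by case: chain.
        - move=> w /(_ m (leqnn _)); rewrite /A ltnn eqxx /= in_itv/= andbT => yw.
          by rewrite lee_fin; apply: fmono; [rewrite (le_trans k0)// ltW|exact: ltW].
      by rewrite integral_cst//; exact: mC.
    apply: (@le_trans _ _ ((f y)%:E * \sum_(0 <= m <oo) P x (C m))%E).
      rewrite -nneseriesZl//.
      apply: (@le_trans _ _ ((f k%:R)%:E * \sum_(0 <= m <oo) \sum_(0 <= i <oo) P x (G m i))%E).
        by apply: lee_wpmul2l; [rewrite lee_fin|exact: le_trans PS PG].
      rewrite -nneseriesZl//; last by move=> m _; exact: nneseries_ge0.
      apply: lee_nneseries => // m _; rewrite mule_ge0// ?lee_fin//; exact: nneseries_ge0.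
    rewrite -[leRHS]mule1; apply: lee_wpmul2l; first by rewrite lee_fin.
    rewrite -(@measure_semi_bigcup _ _ _ (P x) C)//.
    - by apply: probability_le1; exact: bigcup_measurable.
    - have disj i j : (i < j)%N -> C i `&` C j = set0.
        move=> ij; apply/seteqP; split=> // w [/(_ i (leqnn _)) + /(_ i (ltnW ij))].
        by rewrite /A ltnn eqxx ij /= !in_itv/= andbT => yw; rewrite leNgt yw.
      apply/trivIsetP => i j _ _.
      by rewrite neq_ltn => /orP[/disj//|]; rewrite setIC => /disj.
    - exact: bigcup_measurable.
  apply/eqP; rewrite eq_le measure_ge0 andbT leNgt; apply/negP => p0.
  have pfin : P x (bad k) \is a fin_num by exact: fin_num_measure.
  move: p0 key; rewrite -(fineK pfin); set p := fine _; rewrite lte_fin => p0 key.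
  have [|y y0 fy] := finf (Num.min (f k%:R * p) (f k%:R)).
    by rewrite lt_min mulr_gt0 ?fpos.
  move: fy; rewrite lt_min => /andP[fy fyk].
  have ky : k%:R < y.
    by rewrite ltNge; apply/negP => yk; move: fyk; rewrite ltNge fmono.
  by have := key y ky; rewrite -EFinM lee_fin leNgt fy.
have aebad : \forall w \ae P x, forall k, a <= k%:R -> ~ bad k w.
  apply: ae_foralln => k.
  have [ak|ak] := pselect (a <= k%:R); last by apply: aeW => w /ak.
  by exists (bad k); split; [|exact: bad0|move=> w /= /not_implyP[_ /contrapT]].
apply: filterS aebad => w nbad; apply/cvgryPgt => M.
pose k := (Num.truncn (Num.max 0 (Num.max a M))).+1.
have kM : Num.max a M < k%:R by rewrite (le_lt_trans _ (truncnS_gt _))// le_max lexx orbT.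
move: kM; rewrite gt_max => /andP[ak Mk].
have := nbad k (ltW ak); rewrite /bad.
move=> /existsNP[m] /not_implyP[_ hm]; exists m => // n /= mn.
apply: (lt_trans Mk); rewrite ltNge; apply/negP => nk; apply: hm.
by exists (n - m)%N => //=; rewrite subnKC// in_itv.
Qed.

(** [F] is the sum over n of the indicators of tau_b > n, so its mean is the sum of the cylinder
    probabilities, which the surplus [delta] bounds by [f x / delta]. *)
Lemma positive_recurrent_criterion (f : R -> R) (a delta : R) : 0 < delta ->
  (forall y, 0 <= f y) -> measurable_fun setT f ->
  (forall y, X y -> a < y ->
    (\int[P y]_w (f (xi 1 w))%:E + delta%:E <= (f y)%:E)%E) ->
  positive_recurrent X P xi.
Proof.
move=> d0 f0 mf hsup; exists a => b ab x Xx.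
pose A (i : nat) : set R := `]b, +oo[%classic.
have mA i : measurable (A i) by exact: measurable_itv.
have mH n : measurable (cylinder xi A n) by exact: (measurable_cylinder chain).
pose F w := (\sum_(0 <= n <oo) (\1_(cylinder xi A n) w)%:E : \bar R)%E.
have F0 w : (0 <= F w)%E by apply: nneseries_ge0 => n _ _; rewrite lee_fin.
have hF k w : (forall i, (i < k)%N -> b < xi i w) -> (k%:R%:E <= F w)%E.
  move=> hk; apply: (@le_trans _ _ (\sum_(0 <= n < k) (\1_(cylinder xi A n) w)%:E)%E).
    rewrite (eq_big_nat _ _ (F2 := fun=> 1%E)).
      by rewrite sumEFin lee_fin big_const_nat subn0 iter_addr_0.
    move=> i /= ik; rewrite indicE mem_set// => j ji.
    by rewrite /A /= in_itv/= andbT hk// (leq_ltn_trans ji).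
  by apply: nneseries_lim_ge => n _ _; rewrite lee_fin.
have hit w : (hitting_time xi b w <= F w)%E.
  have [ex|nb] := pselect (exists n, xi n w <= b).
    case: (ex_minnP ex) => m mb mmin.
    apply: (@le_trans _ _ m%:R%:E).
      by apply: ereal_inf_lbound; exists m.
    apply: hF => i im; rewrite ltNge; apply/negP => /mmin.
    by rewrite leqNgt im.
  (* The infimum of the empty set is [+oo], so a path that never falls to [b] needs an infinite
     [F w]. *)
  suff -> : F w = +oo%E by exact: leey.
  apply/eqyP => e _; apply: le_trans (hF (Num.truncn e).+1 _ _).
    by rewrite lee_fin ltW// truncnS_gt.
  by move=> i _; rewrite ltNge; apply/negP => ib; apply: nb; exists i.
have hit0 w : (0 <= hitting_time xi b w)%E.
  by apply: le_ereal_inf_tmp => _ [n _ <-]; rewrite lee_fin.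
apply: (@le_lt_trans _ _ (\int[P x]_w F w)%E).
  (* Comparing suprema over the simple functions below each integrand asks for no measurability of
     [hitting_time]. *)
  rewrite !ge0_integralTE//; apply: le_ereal_sup => _ [h /= hh <-].
  by exists h => // w; exact: le_trans (hit w).
rewrite integral_nneseries//; last by move=> n; exact/measurable_EFinP.
have : (delta%:E * \sum_(0 <= n <oo) \int[P x]_w (\1_(cylinder xi A n) w)%:E < +oo)%E.
  apply: le_lt_trans (ltry (f x)).
  apply: (@le_trans _ _ (\sum_(0 <= i <oo) (0%:E * P x (cylinder xi A (0 + i) `&`
      xi (0 + i).+1 @^-1` set0) + delta%:E * P x (cylinder xi A (0 + i))))%E).
    rewrite -nneseriesZl; last first.
      by move=> n _; apply: integral_ge0 => w _; rewrite lee_fin.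
    apply: lee_nneseries => [n _ _|n _].
      apply: mule_ge0; first by rewrite lee_fin ltW.
      by apply: integral_ge0 => w _; rewrite lee_fin.
    by rewrite mul0e add0e add0n integral_indic// setIT.
  apply: le_trans (@markov_series _ _ _ _ _ _ mX chain x 0 delta f A set0 0
      _ _ _ _ _ _ _ _ _ _) _ => //.
  - exact: ltW.
  - by move=> i _; rewrite setI0.
  - by move=> n z _ Xz; rewrite /A /= in_itv/= andbT => bz; apply: hsup => //; exact: le_lt_trans bz.
  apply: (@le_trans _ _ (\int[P x]_(w in cylinder xi A 0) (cst (f x)%:E w))%E).
    apply: ae_ge0_le_integral => //.
    - by move=> w _; rewrite lee_fin.
    - apply: measurable_funTS; apply/measurable_EFinP; apply: measurableT_comp => //.
      by case: chain.
    - by move=> w _ /=; rewrite lee_fin.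
    - by have := chain_start_ae chain x Xx; apply: filterS => w -> _.
  rewrite integral_cst// -[leRHS]mule1; apply: lee_wpmul2l; first by rewrite lee_fin.
  exact: probability_le1.
have [->|Foo] := eqVneq (\sum_(0 <= n <oo) \int[P x]_w (\1_(cylinder xi A n) w)%:E)%E +oo%E.
  by rewrite gt0_muley ?lte_fin// ltxx.
by move=> _; rewrite ltey.
Qed.
End criteria.

(** * Euler's reflection formula *)

Section csc_reflection.
Context {R : realType}.
Implicit Types s t x y : R.

Lemma arch_le0 (a b : R) : (forall n, a * n%:R <= b) -> a <= 0.
Proof.
move=> h; rewrite leNgt; apply/negP => a0.
have := h (Num.truncn (b / a)).+1; rewrite leNgt => /negP; apply.
by rewrite mulrC -ltr_pdivrMr// truncnS_gt.
Qed.

(** Climbs from [cos y <= 1] to the Taylor bounds that follow, each the derivative of the next, and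
    later proves [powRN_defect_pos]. *)
Lemma derive_ge0_ge0 (f f' : R -> R) :
  (forall y, 0 <= y -> is_derive y 1 f (f' y)) ->
  (forall y, 0 <= y -> 0 <= f' y) -> 0 <= f 0 ->
  forall x, 0 <= x -> 0 <= f x.
Proof.
move=> df f'0 f0 x x0.
have d y : y \in `]0, x[ -> is_derive y 1 f (f' y).
  by rewrite in_itv/= => /andP[y0 _]; apply: df; exact: ltW.
have cf : {within `[0, x], continuous f}.
  apply: derivable_within_continuous => y; rewrite in_itv/= => /andP[y0 _].
  by have [] := df y y0.
have [c] := MVT_segment x0 d cf.
rewrite in_itv/= => /andP[c0 _] E.
have : 0 <= f x - f 0 by rewrite E subr0 mulr_ge0// f'0.
lra.
Qed.

Lemma sin_le_id x : 0 <= x -> sin x <= x.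
Proof.
move=> x0; rewrite -subr_ge0.
apply: (@derive_ge0_ge0 (fun y => y - sin y) (fun y => 1 - cos y)) => //.
by rewrite sin0 subr0.
Qed.

Lemma cos_ge_taylor x : 0 <= x -> 1 - x ^+ 2 / 2 <= cos x.
Proof.
move=> x0; rewrite -subr_ge0.
apply: (@derive_ge0_ge0 (fun y => cos y - (1 - y ^+ 2 / 2)) (fun y => y - sin y)) => // [y _|y y0|].
- apply: is_derive_eq; rewrite /GRing.scale/=; lra.
- by rewrite subr_ge0 sin_le_id.
- rewrite cos0; lra.
Qed.

Lemma sin_ge_taylor x : 0 <= x -> x - x ^+ 3 / 6 <= sin x.
Proof.
move=> x0; rewrite -subr_ge0.
apply: (@derive_ge0_ge0 (fun y => sin y - (y - y ^+ 3 / 6)) (fun y => cos y - (1 - y ^+ 2 / 2))) => // [y _|y y0|].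
- apply: is_derive_eq; rewrite /GRing.scale/=; lra.
- by rewrite subr_ge0 cos_ge_taylor.
- rewrite sin0; lra.
Qed.

(** Subtracting 1 / t removes the pole of the cosecant at 0. The derivative of the difference is
    (sin^2 c - c^2 cos c) / (c sin c)^2; by Taylor the numerator is at most c^4 / 2 in absolute
    value and the denominator at least c^4 / 9, so 9 / 2, rounded up to 5, is a bound. *)
Lemma csc_lipschitz s t : 0 < s -> s <= t -> t <= pi / 2 ->
  `|(sin t)^-1 - t^-1 - ((sin s)^-1 - s^-1)| <= 5 * (t - s).
Proof.
move=> s0 st tpi.
have pi4 : pi / 2 < 2 :> R := @pihalf_lt2 R.
have sin0 y : s <= y -> y <= t -> 0 < sin y.
  by move=> sy yt; apply: sin_gt0_pi; lra.
have df y : s <= y -> y <= t -> is_derive y 1 (fun y => (sin y)^-1 - y^-1)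
    (- cos y / sin y ^+ 2 + y ^- 2).
  move=> sy yt; have := sin0 y sy yt => siny.
  have dV : is_derive y 1 (fun y : R => y^-1) (- y ^- 2 *: 1).
    by apply: (@is_deriveV _ id); rewrite gt_eqF//; lra.
  have dS : is_derive y 1 (fun y : R => (sin y)^-1) (- (sin y) ^- 2 *: cos y).
    by apply: (@is_deriveV _ sin); rewrite gt_eqF.
  apply: is_derive_eq; rewrite /GRing.scale/= mulr1 opprK; congr (_ + _).
  by rewrite mulrC mulrN mulNr.
have d y : y \in `]s, t[ -> is_derive y 1 (fun y => (sin y)^-1 - y^-1)
    (- cos y / sin y ^+ 2 + y ^- 2).
  by rewrite in_itv/= => /andP[sy yt]; apply: df; exact: ltW.
have cf : {within `[s, t], continuous (fun y => (sin y)^-1 - y^-1)}.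
  apply: derivable_within_continuous => y; rewrite in_itv/= => /andP[sy yt].
  by have [] := df y sy yt.
have [c] := MVT_segment st d cf.
rewrite in_itv/= => /andP[sc ct] ->.
rewrite normrM [X in _ * X <= _]ger0_norm ?subr_ge0//.
apply: ler_wpM2r; first by rewrite subr_ge0.
have sc0 := sin0 c sc ct; have c0 : 0 < c by lra.
have c2 : c <= 2 by lra.
have cc : c * c <= 4 by nra.
have S1 := sin_le_id c (ltW c0); have S2 := sin_ge_taylor c (ltW c0).
have C1 := cos_ge_taylor c (ltW c0); have C2 := cos_le1 c.
have S3 : c / 3 <= sin c.
  apply: le_trans S2; rewrite -subr_ge0.
  have -> : c - c ^+ 3 / 6 - c / 3 = c * (4 - c * c) / 6 by lra.
  by rewrite divr_ge0// mulr_ge0//; lra.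
have -> : - cos c / sin c ^+ 2 + c ^- 2 = (sin c ^+ 2 - c ^+ 2 * cos c) / (sin c * c) ^+ 2.
  by field; rewrite !gt_eqF.
rewrite normrM normfV [X in _ / X]ger0_norm ?sqr_ge0// ler_pdivrMr; last first.
  by rewrite exprn_gt0// mulr_gt0.
have den : c ^+ 4 / 9 <= (sin c * c) ^+ 2.
  have -> : c ^+ 4 / 9 = (c / 3 * c) ^+ 2 by lra.
  rewrite ler_sqr ?nnegrE; [|nra|nra].
  by rewrite ler_pM2r.
apply: (@le_trans _ _ (c ^+ 4 / 2)); last by have := exprn_ge0 4 (ltW c0); lra.
have sq1 : sin c ^+ 2 <= c ^+ 2 by rewrite ler_sqr ?nnegrE// ltW.
have sq2 : c ^+ 2 - c ^+ 4 / 3 <= sin c ^+ 2.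
  have k0 : 0 <= c - c ^+ 3 / 6.
    have -> : c - c ^+ 3 / 6 = c * (6 - c * c) / 6 by lra.
    by rewrite divr_ge0// mulr_ge0//; lra.
  have : (c - c ^+ 3 / 6) ^+ 2 <= sin c ^+ 2 by rewrite ler_sqr ?nnegrE// ltW.
  have -> : (c - c ^+ 3 / 6) ^+ 2 = c ^+ 2 - c ^+ 4 / 3 + (c ^+ 3 / 6) ^+ 2 by field.
  have := sqr_ge0 (c ^+ 3 / 6); lra.
have c20 : 0 <= c ^+ 2 by exact: sqr_ge0.
have c4 : c ^+ 4 = c ^+ 2 * c ^+ 2 by rewrite -exprD.
have lo : c ^+ 2 * (1 - c ^+ 2 / 2) <= c ^+ 2 * cos c by apply: ler_wpM2l.
have up : c ^+ 2 * cos c <= c ^+ 2 * 1 by apply: ler_wpM2l.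
have c40 : 0 <= c ^+ 4 by exact: exprn_ge0 (ltW c0).
rewrite ler_norml; apply/andP; split; lra.
Qed.

(** The triple angle formula at pi / 3 gives 4 c^3 - 3 c + 1 = (c + 1) (2 c - 1)^2 = 0, and c is
    positive. *)
Lemma cos_pi3 : cos (pi / 3) = 1 / 2 :> R.
Proof.
have pi0 := @pi_gt0 R.
have c0 : 0 < cos (pi / 3 : R) by apply: cos_gt0_pihalf; lra.
have : cos (pi / 3 + pi / 3 + pi / 3 : R) = -1.
  by rewrite -cospi; congr cos; lra.
rewrite !cosD !sinD; have := cos2Dsin2 (pi / 3 : R).
set c := cos _ in c0 *; set s := sin _ => cs E.
have : (c + 1) * (2 * c - 1) ^+ 2 = 0.
  have s2 : s * s = 1 - c * c by move: cs; rewrite !expr2; lra.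
  have -> : (c + 1) * (2 * c - 1) ^+ 2 = (4 * c * c * c - 3 * c) + 1 by ring.
  have -> : 4 * c * c * c - 3 * c = (c * c - s * s) * c - (s * c + c * s) * s.
    have -> : (c * c - s * s) * c - (s * c + c * s) * s = c * c * c - 3 * c * (s * s) by ring.
    by rewrite s2; ring.
  by rewrite E addNr.
move/eqP; rewrite mulf_eq0 sqrf_eq0 => /orP[]/eqP; lra.
Qed.

(** With S = sin x, p = sin (x + pi / 3) and q = sin (x + 2 pi / 3), one has p - q = S, p q = 3 / 4
    - S^2 and sin (3 x) = 4 S p q. Over the common denominator S p q the right-hand side has
    numerator pi (p q + S (p - q)) = 3 pi / 4. *)
Lemma csc_triple s : 0 < s < 1 ->
  3 * (pi / sin (pi * s)) = pi / sin (pi * (s / 3)) - pi / sin (pi * ((s + 1) / 3))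
    + pi / sin (pi * ((s + 2) / 3)).
Proof.
move=> /andP[s0 s1]; have pi0 := @pi_gt0 R.
set x := pi * (s / 3).
have -> : pi * s = x + x + x by rewrite /x; lra.
have -> : pi * ((s + 1) / 3) = x + pi / 3 by rewrite /x; lra.
have -> : pi * ((s + 2) / 3) = x + (pi / 3 + pi / 3) by rewrite /x; lra.
have x0 : 0 < x by rewrite mulr_gt0// divr_gt0.
have x3 : x < pi / 3 by rewrite /x mulrA ltr_pM2r ?invr_gt0// gtr_pMr.
have a0 : 0 < sin x by apply: sin_gt0_pi; lra.
have b0 : 0 < sin (x + pi / 3) by apply: sin_gt0_pi; lra.
have c0 : 0 < sin (x + (pi / 3 + pi / 3)) by apply: sin_gt0_pi; lra.
have d0 : 0 < sin (x + x + x) by apply: sin_gt0_pi; lra.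
move: a0 b0 c0 d0; rewrite !sinD !cosD cos_pi3.
have := cos2Dsin2 x; have := cos2Dsin2 (pi / 3 : R); rewrite cos_pi3.
set u := sin (pi / 3); set S := sin x; set C := cos x => u2 SC a0 b0 c0 d0.
have {}u2 : u * u = 3 / 4 by move: u2; rewrite !expr2; lra.
have C2 : C * C = 1 - S * S by move: SC; rewrite !expr2; lra.
have p0 : 0 < S * (1 / 2) + C * u by [].
set p := S * (1 / 2) + C * u in b0 p0 *.
set q := S * _ + C * _ in c0 *.
set r := (_ * C + _ * S) in d0 *.
have pq : p * q = 3 / 4 - S * S.
  have -> : p * q = C * C * (u * u) + S * C * u * (3 / 4 - u * u) + S * S * (1/2) * (1/4 - u * u).
    by rewrite /p /q; field.
  by rewrite u2 C2; field.
have pSq : p - q = S.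
  have -> : p - q = S * (1 / 4 + u * u) by rewrite /p /q; field.
  by rewrite u2; field.
have rE : r = 4 * S * (p * q).
  have -> : r = 3 * S * (C * C) - S * S * S by rewrite /r; ring.
  by rewrite pq C2; field.
rewrite rE; have {}d0 : 0 < 4 * S * (p * q) by rewrite -rE.
have key : p * q - S * q + S * p = 3 / 4.
  by rewrite -addrA addrC -(addrC (S * p)) -mulrBr pSq pq; lra.
rewrite (_ : _ - _ + _ = pi * (p * q - S * q + S * p) / (S * (p * q))); last first.
  by field; rewrite !gt_eqF.
by rewrite key; field; rewrite !gt_eqF.
Qed.

(* The functional equation divides a Lipschitz constant of [h] by 3, so [h] is
   constant, and then it also forces the constant to vanish. *)
Lemma triple_lipschitz_eq0 (h : R -> R) (K : R) : 0 <= K ->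
  (forall s t, 0 < s -> s <= t -> t <= 1 / 2 -> `|h t - h s| <= K * (t - s)) ->
  (forall s, 0 < s < 1 -> h (1 - s) = h s) ->
  (forall s, 0 < s < 1 -> 3 * h s = h (s / 3) - h ((s + 1) / 3) + h ((s + 2) / 3)) ->
  forall s, 0 < s < 1 -> h s = 0.
Proof.
move=> K0 lip sym tri.
(* The symmetry carries the Lipschitz bound across 1 / 2 to all of (0, 1). *)
have lip1 s t : 0 < s -> s <= t -> t < 1 -> `|h t - h s| <= K * (t - s).
  move=> s0 st t1.
  have lip2 u v : 1 / 2 <= u -> u <= v -> v < 1 -> `|h v - h u| <= K * (v - u).
    move=> hu uv v1; rewrite -(sym v); last lra.
    rewrite -(sym u); last lra.
    rewrite distrC.
    by rewrite (_ : v - u = 1 - u - (1 - v)); [apply: lip; lra|lra].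
  have [th|ht] := leP t (1 / 2); first exact: lip.
  have [sh|hs] := leP s (1 / 2); last by apply: lip2 => //; lra.
  rewrite (_ : h t - h s = (h t - h (1 / 2)) + (h (1 / 2) - h s)); last by ring.
  apply: (le_trans (ler_normD _ _)).
  rewrite (_ : K * (t - s) = K * (t - 1 / 2) + K * (1 / 2 - s)); last by ring.
  by apply: lerD; [apply: lip2 => //; lra|apply: lip => //; lra].
have tri3 (a b c a' b' c' : R) :
    `|(a - b + c) - (a' - b' + c')| <= `|a - a'| + `|b - b'| + `|c - c'|.
  rewrite (_ : _ - _ = (a - a') + (b' - b) + (c - c')); last by ring.
  rewrite (distrC b); apply: (le_trans (ler_normD _ _)).
  by rewrite lerD2r; exact: ler_normD.
(* Each of the three arguments moves by [(t - s) / 3], together by [t - s], while the left-hand side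
   carries a factor 3: every application gains one power of 3. *)
have lipn n s t : 0 < s -> s <= t -> t < 1 -> `|h t - h s| * 3 ^+ n <= K * (t - s).
  elim: n s t => [|n ih] s t s0 st t1; first by rewrite mulr1 lip1.
  have -> : `|h t - h s| * 3 ^+ n.+1 = `|3 * h t - 3 * h s| * 3 ^+ n.
    by rewrite -mulrBr normrM exprS [`|3|]ger0_norm//; ring.
  rewrite !tri; [|lra|lra].
  have i1 : `|h (t / 3) - h (s / 3)| * 3 ^+ n <= K * (t / 3 - s / 3) by apply: ih; lra.
  have i2 : `|h ((t + 1) / 3) - h ((s + 1) / 3)| * 3 ^+ n <= K * ((t + 1) / 3 - (s + 1) / 3) by apply: ih; lra.
  have i3 : `|h ((t + 2) / 3) - h ((s + 2) / 3)| * 3 ^+ n <= K * ((t + 2) / 3 - (s + 2) / 3) by apply: ih; lra.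
  apply: (@le_trans _ _ ((`|h (t / 3) - h (s / 3)| + `|h ((t + 1) / 3) - h ((s + 1) / 3)|
      + `|h ((t + 2) / 3) - h ((s + 2) / 3)|) * 3 ^+ n)); last by lra.
  apply: ler_wpM2r; first by rewrite exprn_ge0.
  exact: tri3.
have cst s t : 0 < s -> s <= t -> t < 1 -> h t = h s.
  move=> s0 st t1; apply/eqP; rewrite -subr_eq0 -normr_le0.
  apply: (@arch_le0 _ (K * (t - s))) => n; apply: le_trans (lipn n s t s0 st t1).
  apply: ler_wpM2l => //; rewrite -natrX ler_nat.
  by apply: ltnW; exact: ltn_expl.
move=> s s01; have := tri s s01.
have e1 : h s = h (s / 3) by apply: cst; lra.
have e2 : h ((s + 1) / 3) = h (s / 3) by apply: cst; lra.
have e3 : h ((s + 2) / 3) = h (s / 3) by apply: cst; lra.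
lra.
Qed.

(** * Functions satisfying B s + B (s + 1) = 1 / s *)

Section beta.
Variable B : R -> R.
Hypothesis B_ge0 : forall s, 0 < s -> 0 <= B s.
Hypothesis B_noninc : forall s t, 0 < s -> s <= t -> B t <= B s.
Hypothesis B_shift : forall s, 0 < s -> B s + B (s + 1) = s^-1.

Lemma beta_triple s : 0 < s -> 3 * B s = B (s / 3) - B ((s + 1) / 3) + B ((s + 2) / 3).
Proof.
(* The defect [D] satisfies [D (t + 1) = - D t] and tends to 0 at infinity. *)
pose D s := 3 * B s - (B (s / 3) - B ((s + 1) / 3) + B ((s + 2) / 3)).
have DS t : 0 < t -> D (t + 1) = - D t.
  move=> t0; apply/eqP; rewrite -subr_eq0 opprK; apply/eqP; rewrite /D.
  have e1 := B_shift t t0.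
  have e2 := B_shift (t / 3) (divr_gt0 t0 (ltr0n _ 3)).
  have -> : (t + 1 + 1) / 3 = (t + 2) / 3 by lra.
  have -> : (t + 1 + 2) / 3 = t / 3 + 1 by lra.
  have e3 : (t / 3)^-1 = 3 * t^-1 by field; rewrite gt_eqF.
  rewrite e3 in e2; lra.
have DN n t : 0 < t -> `|D (t + n%:R)| = `|D t|.
  move=> t0; elim: n => [|n ih]; first by rewrite addr0.
  by rewrite -natr1 addrA DS ?normrN// ltr_wpDr.
have Bb t : 0 < t -> B t <= t^-1.
  by move=> t0; have := B_shift t t0; have := B_ge0 (t + 1); lra.
(* The 12 collects 3 / t from [3 * B t] and 3 / t from each of the other three terms. *)
have Db t : 0 < t -> `|D t| <= 12 * t^-1.
  move=> t0; have t3 : (t / 3)^-1 = 3 * t^-1 by field; rewrite gt_eqF.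
  have b k : 0 <= k -> 0 <= B ((t + k) / 3) <= 3 * t^-1.
    move=> k0; apply/andP; split; first by apply: B_ge0; lra.
    rewrite -t3; apply: (@le_trans _ _ (B (t / 3))); last by apply: Bb; lra.
    by apply: B_noninc; lra.
  have b0 := b 0 (lexx _); have b1 := b 1 ler01; have b2 := b 2 (ler0n _ 2).
  have b3 := Bb t t0; have b4 := B_ge0 t t0.
  rewrite addr0 in b0; rewrite /D ler_norml; apply/andP; split; lra.
move=> s0; apply/eqP; rewrite -subr_eq0 -normr_le0 -/(D s).
apply: (@arch_le0 _ 12) => n.
have sn : 0 < s + n%:R by rewrite ltr_wpDr.
have := Db _ sn; rewrite DN// ler_pdivlMr// => h.
by apply: le_trans h; apply: ler_wpM2l => //; rewrite lerDr ltW.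
Qed.

(** The difference of the two sides is symmetric and satisfies the triplication formula, by
    [beta_triple] at [s] and [1 - s] and by [csc_triple]. It is Lipschitz because [B_shift] writes
    [B s] as 1 / s minus a tame function, and the pole 1 / s is also that of the cosecant term. *)
Lemma beta_reflection s : 0 < s < 1 -> B s + B (1 - s) = pi / sin (pi * s).
Proof.
move=> s01; apply/eqP; rewrite -subr_eq0; apply/eqP; move: s s01.
have pi0 := @pi_gt0 R.
(* The drop of [B] from [s + 1] to [t + 1] is that of 1 / u minus the drop of [B] one unit further,
   which is nonnegative by monotonicity. *)
have lipB s t : 0 < s -> s <= t -> 0 <= B (s + 1) - B (t + 1) <= t - s.
  move=> s0 st; have h0 := B_noninc (s + 1) (t + 1); have h1 := B_noninc (s + 1 + 1) (t + 1 + 1).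
  have e1 := B_shift (s + 1); have e2 := B_shift (t + 1).
  have : (s + 1)^-1 - (t + 1)^-1 <= t - s.
    rewrite (_ : _ - _ = (t - s) / ((s + 1) * (t + 1))); last by field; rewrite !gt_eqF//; lra.
    rewrite ler_pdivrMr; last by rewrite mulr_gt0//; lra.
    by rewrite ler_peMr ?subr_ge0//; nra.
  lra.
(* [5 * pi * pi] is the constant of [csc_lipschitz] scaled by pi in argument and value. The 6 is 4
   for 1 / (1 - s) on (0, 1/2] plus 1 for each of the two shifted values of [B]. *)
apply: (@triple_lipschitz_eq0 _ (6 + 5 * pi * pi)) => [|s t s0 st t2|s /andP[s0 s1]|s /andP[s0 s1]].
- by rewrite addr_ge0// mulr_ge0// ltW// mulr_gt0.
- have /andP[l1 l2] := lipB s t s0 st.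
  have t1' : 0 < 1 - t by lra.
  have ts' : 1 - t <= 1 - s by lra.
  have /andP[l3 l4] := lipB (1 - t) (1 - s) t1' ts'.
  have e1 := B_shift s s0; have e2 := B_shift t (lt_le_trans s0 st).
  have e3 := B_shift (1 - s) (lt_le_trans t1' ts'); have e4 := B_shift (1 - t) t1'.
  have h : `|(sin (pi * t))^-1 - (pi * t)^-1 - ((sin (pi * s))^-1 - (pi * s)^-1)|
      <= 5 * (pi * t - pi * s).
    apply: csc_lipschitz; first exact: mulr_gt0.
    - by rewrite ler_pM2l.
    - by rewrite ler_pM2l//; lra.
  have {}h : `|pi / sin (pi * t) - t^-1 - (pi / sin (pi * s) - s^-1)| <= 5 * pi * pi * (t - s).
    rewrite (_ : _ - _ - _ = pi * ((sin (pi * t))^-1 - (pi * t)^-1 - ((sin (pi * s))^-1 - (pi * s)^-1))).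
      rewrite normrM (ger0_norm (ltW pi0)).
      by apply: (le_trans (ler_wpM2l (ltW pi0) h)); lra.
    by rewrite !invfM !mulrBr !mulrA mulfV ?gt_eqF// !mul1r.
  have v : 0 <= (1 - t)^-1 - (1 - s)^-1 <= 4 * (t - s).
    rewrite (_ : _ - _ = (t - s) / ((1 - s) * (1 - t))); last by field; rewrite !gt_eqF//; lra.
    have p : 1 / 4 <= (1 - s) * (1 - t) by nra.
    have p0 : 0 < (1 - s) * (1 - t) by lra.
    by rewrite divr_ge0 ?subr_ge0 ?(ltW p0)//= ler_pdivrMr//; nra.
  move: h; rewrite !ler_norml !mulrDl => /andP[h1 h2].
  rewrite (_ : B (1 - t + 1) = B (1 - t + 1)) // in l3 l4 e4 *.
  by apply/andP; split; lra.
- have -> : pi * (1 - s) = - (pi * s) + pi by ring.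
  rewrite sinDpi sinN opprK (_ : 1 - (1 - s) = s); [lra|lra].
- rewrite mulrBr mulrDr beta_triple// (beta_triple (1 - s)) ?subr_gt0// csc_triple ?s0//.
  have -> : 1 - s / 3 = (1 - s + 2) / 3 by lra.
  have -> : 1 - (s + 1) / 3 = (1 - s + 1) / 3 by lra.
  have -> : 1 - (s + 2) / 3 = (1 - s) / 3 by lra.
  lra.
Qed.
End beta.
End csc_reflection.

(** * Integrals in logarithmic scale *)

Section exponential_integrals.
Context {R : realType}.
Local Notation mu := (@lebesgue_measure R).
Implicit Types s x y z b l : R.

Lemma cvg_expRNy s : 0 < s -> expR (s * x) @[x --> -oo] --> (0 : R).
Proof.
move=> s0; apply/cvgNy_compNP.
under eq_fun do rewrite /= mulrN.
apply: (@cvg_comp _ _ _ (fun x => s * x) (fun y => expR (- y)) _ +oo); last exact: cvgr_expR.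
exact: gt0_cvgMry.
Qed.

Lemma ge0_continuous_FTC2Ny (f F : R -> R) (b l : R) :
  (forall x, 0 <= f x) -> continuous f -> (forall x, is_derive x 1 F (f x)) ->
  F x @[x --> -oo] --> l ->
  (\int[mu]_(x in `]-oo, b]) (f x)%:E = (F b - l)%:E)%E.
Proof.
move=> f0 cf dF Fl.
rewrite -(opprK b) ge0_integration_by_substitutionNy; last 2 first.
- exact: continuous_subspaceT.
- by move=> x _; exact: f0.
have dN x : is_derive x 1 (- (F \o -%R)) (f (- x)).
  have dFx := dF (- x).
  have d1 : is_derive x 1 (F \o -%R) (f (- x) * -1) by apply: is_derive1_comp.
  by apply: is_derive_eq; rewrite mulrN1 opprK.
rewrite (@ge0_continuous_FTC2y _ _ (- (F \o -%R)) _ (- l)).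
- rewrite -EFinB; congr (_%:E).
  by rewrite (_ : (- (F \o -%R)) (- b) = - F (- - b))//; ring.
- by move=> x _; exact: f0.
- apply: continuous_subspaceT => x; apply: continuous_comp; [exact: continuousN|exact: cf].
- by apply: cvgN; apply/cvgNy_compNP.
- by move=> x _; have [] := dN x.
- apply: cvg_at_right_filter; apply: differentiable_continuous; apply/derivable1_diffP.
  by have [] := dN (- b).
- by move=> x _; rewrite derive1E derive_val.
Qed.

Lemma is_derive_expRM s x : is_derive x 1 (fun y => expR (s * y)) (s * expR (s * x)).
Proof.
have d : is_derive x 1 (fun y => s * y) s.
  by apply: is_derive_eq; rewrite /GRing.scale/= mulr1.
by rewrite [X in is_derive _ _ _ X]mulrC; apply: (@is_derive1_comp _ expR).
Qed.

Lemma continuous_expRM s : continuous (fun x => expR (s * x)).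
Proof.
move=> x; apply: differentiable_continuous; apply/derivable1_diffP.
by have [] := is_derive_expRM s x.
Qed.

Lemma integral_expRNy s b : 0 < s ->
  (\int[mu]_(x in `]-oo, b]) (expR (s * x))%:E = (expR (s * b) / s)%:E)%E.
Proof.
move=> s0; have dF x : is_derive x 1 (fun x => s^-1 * expR (s * x)) (expR (s * x)).
  have d := is_derive_expRM s x.
  by apply: is_derive_eq; rewrite /GRing.scale/= mulKf ?gt_eqF.
have F0 : s^-1 * expR (s * x) @[x --> -oo] --> 0.
  by rewrite -[X in _ --> X](mulr0 s^-1); apply: cvgMr; exact: cvg_expRNy.
rewrite (ge0_continuous_FTC2Ny _ _ b 0 _ _ dF F0).
- by rewrite subr0 mulrC.
- by move=> x; exact: expR_ge0.
- exact: continuous_expRM.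
Qed.

(** With u = e^x this is the Beta integrand u^(s - 1) / (1 + u) on the positive half-line. *)
Definition logit_integrand s x := expR (s * x) / (1 + expR x).

Lemma one_expR_gt0 x : 0 < 1 + expR x.
Proof. by rewrite addr_gt0// expR_gt0. Qed.

Lemma logit_integrand_ge0 s x : 0 <= logit_integrand s x.
Proof. by rewrite divr_ge0 ?expR_ge0// ltW// one_expR_gt0. Qed.

Lemma continuous_logit_integrand s : continuous (logit_integrand s).
Proof.
move=> x; apply: cvgM; first exact: continuous_expRM.
apply: cvgV; first by rewrite gt_eqF// one_expR_gt0.
by apply: cvgD; [exact: cvg_cst|exact: continuous_expR].
Qed.

Lemma measurable_logit_integrand s (D : set R) :
  measurable_fun D (fun x => (logit_integrand s x)%:E).
Proof.
apply/measurable_EFinP; apply: measurable_funTS.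
by apply: continuous_measurable_fun; exact: continuous_logit_integrand.
Qed.

(** The function B of the reflection argument, that is, the integral of u^(s - 1) / (1 + u) over (0,
    1]. It is extended real because its finiteness is deduced from the shift identity. *)
Definition half_integral s : \bar R :=
  (\int[mu]_(x in `]-oo, 0%R]) (logit_integrand s x)%:E)%E.

Lemma half_integral_ge0 s : (0 <= half_integral s)%E.
Proof. by apply: integral_ge0 => x _; rewrite lee_fin logit_integrand_ge0. Qed.

(** The numerators add up to e^(sx) (1 + e^x), the denominator cancels, and e^(sx) integrates to 1 /
    s. *)
Lemma half_integral_shift s : 0 < s ->
  (half_integral s + half_integral (s + 1) = s^-1%:E)%E.
Proof.
move=> s0; rewrite /half_integral -ge0_integralD//.
- under eq_integral => x _.
    rewrite -EFinD /logit_integrand mulrDl expRD mul1r -mulrDl.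
    rewrite -[X in X + _]mulr1 -mulrDr mulfK ?gt_eqF ?one_expR_gt0//.
    over.
  by rewrite integral_expRNy// mulr0 expR0 mul1r.
- by move=> x _; rewrite lee_fin logit_integrand_ge0.
- exact: measurable_logit_integrand.
- by move=> x _; rewrite lee_fin logit_integrand_ge0.
- exact: measurable_logit_integrand.
Qed.

Lemma half_integral_fin s : 0 < s -> half_integral s \is a fin_num.
Proof.
move=> s0; rewrite ge0_fin_numE ?half_integral_ge0//.
apply: le_lt_trans (ltry s^-1); rewrite -half_integral_shift//.
by rewrite leeDl// half_integral_ge0.
Qed.

Lemma half_integral_reflection s : 0 < s < 1 ->
  (half_integral s + half_integral (1 - s) = (pi / sin (pi * s))%:E)%E.
Proof.
move=> /andP[s0 s1]; have s1' : 0 < 1 - s by rewrite subr_gt0.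
rewrite -(fineK (half_integral_fin s s0)) -(fineK (half_integral_fin _ s1')) -EFinD.
congr EFin; apply: (@beta_reflection R (fine \o half_integral)) => [t t0|t u t0 tu|t t0|].
- by rewrite fine_ge0// half_integral_ge0.
- have u0 := lt_le_trans t0 tu.
  rewrite fine_le ?half_integral_fin//; apply: ge0_le_integral => //.
  + by move=> x _; rewrite lee_fin logit_integrand_ge0.
  + exact: measurable_logit_integrand.
  + exact: measurable_logit_integrand.
  + move=> x /=; rewrite in_itv/= => x0; rewrite lee_fin ler_pM2r ?invr_gt0 ?one_expR_gt0//.
    by rewrite ler_expR ler_wnM2r.
- have t1 : 0 < t + 1 by rewrite addr_gt0.
  have := half_integral_shift t t0.
  by rewrite -(fineK (half_integral_fin t t0)) -(fineK (half_integral_fin _ t1)) -EFinD => -[].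
- by rewrite s0.
Qed.

(** The substitution x -> -x turns the integrand on the positive half-line into the one with [1 - s]
    on the negative half-line. *)
Lemma integral_logit_integrand s : 0 < s < 1 ->
  (\int[mu]_x (logit_integrand s x)%:E = (pi / sin (pi * s))%:E)%E.
Proof.
move=> s01; rewrite -half_integral_reflection//.
have -> : [set: R] = `]-oo, 0%R]%classic `|` `]0%R, +oo[%classic.
  by apply/seteqP; split=> // x _ /=; rewrite !in_itv/= andbT; case: leP; [left|right].
rewrite ge0_integral_setU//=; last 3 first.
- exact: measurable_logit_integrand.
- by move=> x _; rewrite lee_fin logit_integrand_ge0.
- apply/disj_setPS => x [] /=; rewrite !in_itv/= andbT => h; by rewrite ltNge h.
congr (_ + _)%E; rewrite integral_itv_obnd_cbnd; last exact: measurable_logit_integrand.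
rewrite (@ge0_integration_by_substitution0 _ (fun x => (logit_integrand s x)%:E)).
- apply: eq_integral => x _; congr EFin; rewrite /logit_integrand mulrBl mul1r expRB mulrN !expRN.
  have e0 := expR_gt0 x; have e1 := expR_gt0 (s * x); have e2 := one_expR_gt0 x.
  by field; rewrite !gt_eqF//; lra.
- exact: measurable_logit_integrand.
- by move=> x; rewrite lee_fin logit_integrand_ge0.
Qed.

(** e^z - ln (1 + e^z) is an antiderivative of [logit_integrand 2] vanishing at [-oo]; its value at
    z = ln V is the defect. Tonelli on the region e^z < V then moves the expectation inside. *)
Lemma expectation_log_defect (d : measure_display) (T : measurableType d)
    (Q : probability T R) (V : T -> R) :
  measurable_fun setT V -> (forall w, 0 <= V w) ->
  (\int[Q]_w (V w - ln (1 + V w))%:E =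
   \int[mu]_z ((logit_integrand 2 z)%:E * Q [set w | (expR z < V w)%R]))%E.
Proof.
move=> mV V0.
pose f (p : T * measurableTypeR R) : \bar R :=
  (logit_integrand 2 p.2 * (expR p.2 < V p.1)%R%:R)%:E.
have f0 p : (0 <= f p)%E by rewrite lee_fin mulr_ge0// logit_integrand_ge0.
have mexp : measurable_fun setT (@expR R).
  by apply: continuous_measurable_fun; exact: continuous_expR.
have mf : measurable_fun setT f.
  apply/measurable_EFinP; apply: measurable_funM.
    apply: measurableT_comp => //.
    by apply: continuous_measurable_fun; exact: continuous_logit_integrand.
  apply: (@measurableT_comp _ _ _ _ _ _ (fun b : bool => b%:R : R)) => //.
  by apply: measurable_fun_ltr; apply: measurableT_comp.
have mVz z : measurable [set w | expR z < V w].
  have := measurable_fun_ltr (@measurable_cst _ _ _ _ setT (expR z)) mV.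
  by move=> /(_ measurableT [set true]); rewrite setTI; apply.
transitivity (\int[Q]_w \int[mu]_z f (w, z))%E; last first.
  rewrite fubini_tonelli//; apply: eq_integral => z _; rewrite /f/=.
  under eq_integral => w _ do rewrite EFinM.
  rewrite ge0_integralZl_EFin//; last 2 first.
  - apply/measurable_EFinP.
    apply: (@measurableT_comp _ _ _ _ _ _ (fun b : bool => b%:R : R)) => //.
    exact: measurable_fun_ltr.
  - exact: logit_integrand_ge0.
  congr (_ * _)%E; rewrite -[X in _ = Q X]setIT -integral_indic//.
  apply: eq_integral => w _; rewrite indicE; congr ((nat_of_bool _)%:R%:E).
  by apply/idP/idP; rewrite inE.
apply: eq_integral => w _; rewrite /f/=.
(* At 0 the logarithm has the default value 0, which would give the wrong interval: no z satisfies
   e^z < 0. *)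
have [v0|v0] := eqVneq (V w) 0.
  rewrite v0 addr0 ln1 subr0 integral0_eq// => z _.
  by rewrite ltNge expR_ge0 mulr0.
have {}v0 : 0 < V w by rewrite lt_neqAle eq_sym v0 V0.
rewrite (_ : (V w - ln (1 + V w))%:E =
   \int[mu]_(z in `]-oo, ln (V w)]) (logit_integrand 2 z)%:E)%E; last first.
  have dF z : is_derive z 1 (fun z => expR z - ln (1 + expR z)) (logit_integrand 2 z).
    have e0 := one_expR_gt0 z.
    have d1 : is_derive z 1 (fun z => 1 + expR z) (expR z).
      by rewrite -[X in is_derive _ _ _ X]add0r; apply: is_deriveD.
    have d2 := is_derive1_ln e0.
    have d3 : is_derive z 1 (@ln R \o (fun z => 1 + expR z)) ((1 + expR z)^-1 * expR z).
      exact: is_derive1_comp.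
    apply: is_derive_eq; rewrite /logit_integrand mulr_natl mulr2n expRD.
    by field; rewrite gt_eqF.
  have F0 : expR z - ln (1 + expR z) @[z --> -oo] --> (0 : R).
    have e0 : expR z @[z --> -oo] --> (0 : R).
      by have := @cvg_expRNy 1 ltr01; under eq_fun do rewrite mul1r.
    suff : expR z - ln (1 + expR z) @[z --> -oo] --> (0 - 0 : R) by rewrite subrr.
    apply: cvgB => //.
    apply: (@cvg_comp _ _ _ (fun z => 1 + expR z) (@ln R) _ (nbhs (1 + 0 : R))).
      by apply: cvgD => //; exact: cvg_cst.
    have h : ln x @[x --> (1 : R)] --> ln (1 : R) by exact: continuous_ln.
    by rewrite addr0; rewrite ln1 in h.
  rewrite (ge0_continuous_FTC2Ny _ _ _ 0 _ _ dF F0).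
  - by rewrite subr0 lnK.
  - exact: logit_integrand_ge0.
  - exact: continuous_logit_integrand.
rewrite -integral_itv_bndo_bndc; last exact: measurable_logit_integrand.
rewrite integral_mkcond; apply: eq_integral => z _.
rewrite patchE /=.
have -> : (expR z < V w) = (z < ln (V w)) by rewrite -[in RHS]ltr_expR lnK.
case: ifPn => [/set_mem|/negP hz] /=.
  by rewrite in_itv/= => ->; rewrite mulr1.
case: ltP => [zV|_]; last by rewrite mulr0.
by exfalso; apply: hz; rewrite mem_set//= in_itv.
Qed.
End exponential_integrals.

(** * Heavy tails and the logarithmic defect *)

Section tail_asymptotics.
Context {R : realType} {d : measure_display} {T : measurableType d}.
Variables (Q : probability T R) (W : T -> R) (alpha y0 X : R).
Hypotheses (mW : measurable_fun setT W) (W0 : forall w, 0 <= W w).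
Hypotheses (alpha1 : 1 < alpha) (alpha2 : alpha < 2) (y00 : 0 < y0) (X0 : 0 < X).
Local Notation mu := (@lebesgue_measure R).
Local Notation L := (pi / `|sin (pi * alpha)|).

(** [X] is now a scale, later 1 + x. From [b] on, X e^z is at least [y0], so the tail bounds
    apply. *)
Local Notation b := (ln (y0 / X)).

Let expb : expR b = y0 / X.
Proof. by rewrite lnK// posrE divr_gt0. Qed.

Lemma csc_norm : pi / sin (pi * (2 - alpha)) = L.
Proof.
have pi0 := @pi_gt0 R.
have E : sin (pi * (2 - alpha)) = - sin (pi * alpha).
  by rewrite mulrBr mulr_natr addrC sinD2pi sinN.
have s0 : 0 < sin (pi * (2 - alpha)).
  apply: sin_gt0_pi; apply/andP; split; first by rewrite mulr_gt0// subr_gt0.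
  by rewrite gtr_pMr// ltrBlDr -[2]/(1 + 1) ltrD2l.
by rewrite E ltr0_norm// -oppr_gt0 -E.
Qed.

Let integral_L : (\int[mu]_z (logit_integrand (2 - alpha) z)%:E = L%:E)%E.
Proof. by rewrite integral_logit_integrand ?csc_norm//; rewrite subr_gt0 alpha2/= ltrBlDr -[2]/(1 + 1) ltrD2l. Qed.

Let mS y : measurable [set w | y < W w].
Proof.
have := measurable_fun_ltr (@measurable_cst _ _ _ _ setT y) mW.
by move=> /(_ measurableT [set true]); rewrite setTI; apply.
Qed.

Let Edefect : (\int[Q]_w (W w / X - ln (1 + W w / X))%:E =
   \int[mu]_z ((logit_integrand 2 z)%:E * Q [set w | (X * expR z < W w)%R]))%E.
Proof.
rewrite (@expectation_log_defect _ _ _ Q (fun w => W w / X)).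
- apply: eq_integral => z _; congr (_ * Q _)%E; apply/seteqP; split=> w /=;
    by rewrite ltr_pdivlMr// mulrC.
- exact: measurable_funM.
- by move=> w; rewrite divr_ge0// ltW.
Qed.

Let mprob : measurable_fun setT (fun z => Q [set w | (X * expR z < W w)%R]).
Proof.
have ni y z : y <= z -> (Q [set w | (X * expR z < W w)%R] <= Q [set w | (X * expR y < W w)%R])%E.
  move=> yz; apply: le_measure; rewrite ?inE// => w /=.
  by apply: le_lt_trans; rewrite ler_pM2l// ler_expR.
have fin z : Q [set w | (X * expR z < W w)%R] \is a fin_num by exact: fin_num_measure.
rewrite (_ : (fun z => _) = EFin \o (fun z => fine (Q [set w | (X * expR z < W w)%R]))).
  apply/measurable_EFinP; apply: nonincreasing_measurable => // y z yz.
  by apply: fine_le; [exact: fin|exact: fin|exact: ni].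
by apply/funext => z /=; rewrite fineK.
Qed.

Let mk : measurable_fun setT
  (fun z => (logit_integrand 2 z)%:E * Q [set w | (X * expR z < W w)%R])%E.
Proof. by apply: emeasurable_funM => //; exact: measurable_logit_integrand. Qed.

(** The origin of s = 2 - alpha: the power tail lowers the exponent 2 by alpha and releases the
    factor X^-alpha. *)
Let logit_shift z : logit_integrand 2 z * (X * expR z) `^ (- alpha) =
  X `^ (- alpha) * logit_integrand (2 - alpha) z.
Proof.
rewrite powRM ?expR_ge0 ?(ltW X0)// -expRM /logit_integrand.
rewrite (_ : (2 - alpha) * z = 2 * z + z * - alpha); last by ring.
by rewrite expRD; ring.
Qed.

Let far (z : R) : b <= z -> y0 <= X * expR z.
Proof. by rewrite -ler_expR expb ler_pdivrMr// mulrC. Qed.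

Let integral_below (s : R) : 0 < s ->
  (\int[mu]_z ((expR (s * z))%:E * (\1_`]-oo, b] z)%:E) = ((y0 / X) `^ s / s)%:E)%E.
Proof.
move=> s0; have -> : (y0 / X) `^ s = expR (s * b) by rewrite (mulrC s) expRM expb.
rewrite -integral_expRNy// [RHS]integral_mkcond.
by apply: eq_integral => z _; rewrite patchE indicE; case: ifPn => _; rewrite ?mule1 ?mule0.
Qed.

Let mbelow (s : R) : measurable_fun setT (fun z : R => (expR (s * z))%:E * (\1_`]-oo, b] z)%:E)%E.
Proof.
apply: emeasurable_funM; apply/measurable_EFinP.
  by apply: continuous_measurable_fun; exact: continuous_expRM.
exact: measurable_indic.
Qed.

Let below0 (s z : R) : (0 <= (expR (s * z))%:E * (\1_`]-oo, b] z)%:E)%E.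
Proof. by rewrite mule_ge0// lee_fin// expR_ge0. Qed.

(** Below [b] the probability is bounded by 1 and the integrand by e^(2z), at a cost of order X^-2,
    small against X^-alpha. Above [b] the tail bound is integrated, and extending it to the whole
    line only increases it. *)
Lemma log_defect_upper C : 0 <= C ->
  (forall y, y0 <= y -> (Q [set w | (y < W w)%R] <= (C * y `^ (- alpha))%:E)%E) ->
  (\int[Q]_w (W w / X - ln (1 + W w / X))%:E
    <= ((y0 / X) `^ 2 / 2 + C * X `^ (- alpha) * L)%:E)%E.
Proof.
move=> C0 tail; rewrite Edefect EFinD -integral_below// EFinM -integral_L.
have CX0 : 0 <= C * X `^ (- alpha) by rewrite mulr_ge0// powR_ge0.
rewrite -ge0_integralZl_EFin//; last 2 first.
- by move=> z _; rewrite lee_fin logit_integrand_ge0.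
- exact: measurable_logit_integrand.
have mL : measurable_fun setT
    (fun z => (C * X `^ (- alpha))%:E * (logit_integrand (2 - alpha) z)%:E)%E.
  by apply: emeasurable_funM => //; exact: measurable_logit_integrand.
have L0 z : (0 <= (C * X `^ (- alpha))%:E * (logit_integrand (2 - alpha) z)%:E)%E.
  by rewrite mule_ge0// lee_fin// logit_integrand_ge0.
rewrite -ge0_integralD//; last exact: mbelow.
apply: ge0_le_integral => //.
- by move=> z _; rewrite mule_ge0// lee_fin; exact: logit_integrand_ge0.
- by apply: emeasurable_funD => //; exact: mbelow.
move=> z _; have [zb|bz] := leP z b.
  apply: (@le_trans _ _ ((expR (2 * z))%:E * (\1_`]-oo, b] z)%:E)%E); last by rewrite leeDl.
  rewrite indicE mem_set /=; last by rewrite in_itv.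
  rewrite mule1 -[leRHS]mule1; apply: lee_pmul => //.
  - by rewrite lee_fin logit_integrand_ge0.
  - rewrite lee_fin /logit_integrand ler_pdivrMr ?one_expR_gt0// ler_peMr ?expR_ge0//.
    by rewrite lerDl expR_ge0.
  - exact: probability_le1.
apply: (@le_trans _ _ ((C * X `^ (- alpha))%:E * (logit_integrand (2 - alpha) z)%:E)%E);
  last by rewrite leeDr.
rewrite -EFinM -mulrA -logit_shift mulrCA [leRHS]EFinM.
by apply: lee_wpmul2l; [rewrite lee_fin logit_integrand_ge0|apply: tail; apply: far; exact: ltW].
Qed.

(** The tail bound says nothing below [b]; the missing piece of the full integral is put on the
    right-hand side instead of being subtracted. It is smaller than the main term by a factor of
    order X^(alpha - 2). *)
Lemma log_defect_lower C : 0 <= C ->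
  (forall y, y0 <= y -> ((C * y `^ (- alpha))%:E <= Q [set w | (y < W w)%R])%E) ->
  ((C * X `^ (- alpha) * L)%:E <=
    \int[Q]_w (W w / X - ln (1 + W w / X))%:E
      + (C * X `^ (- alpha) * ((y0 / X) `^ (2 - alpha) / (2 - alpha)))%:E)%E.
Proof.
move=> C0 tail; have a2 : 0 < 2 - alpha by rewrite subr_gt0.
rewrite Edefect [in leLHS]EFinM -integral_L [in leRHS]EFinM -integral_below//.
have CX0 : 0 <= C * X `^ (- alpha) by rewrite mulr_ge0// powR_ge0.
rewrite -!ge0_integralZl_EFin//; last 2 first.
- by move=> z _; rewrite lee_fin logit_integrand_ge0.
- exact: measurable_logit_integrand.
have mL : measurable_fun setT
    (fun z => (C * X `^ (- alpha))%:E * (logit_integrand (2 - alpha) z)%:E)%E.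
  by apply: emeasurable_funM => //; exact: measurable_logit_integrand.
have L0 z : (0 <= (C * X `^ (- alpha))%:E * (logit_integrand (2 - alpha) z)%:E)%E.
  by rewrite mule_ge0// lee_fin// logit_integrand_ge0.
have mB : measurable_fun setT (fun z => (C * X `^ (- alpha))%:E *
    ((expR ((2 - alpha) * z))%:E * (\1_`]-oo, b] z)%:E))%E by apply: emeasurable_funM => //; exact: mbelow.
have B0 z : (0 <= (C * X `^ (- alpha))%:E *
    ((expR ((2 - alpha) * z))%:E * (\1_`]-oo, b] z)%:E))%E by rewrite mule_ge0.
have k0 z : (0 <= (logit_integrand 2 z)%:E * Q [set w | (X * expR z < W w)%R])%E.
  by rewrite mule_ge0// lee_fin logit_integrand_ge0.
rewrite -ge0_integralD//.
apply: ge0_le_integral => //.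
  by apply: emeasurable_funD.
move=> z _; have [zb|bz] := leP z b.
  apply: le_trans (leeDr _ (k0 z)).
  apply: lee_wpmul2l => //.
  rewrite indicE mem_set /=; last by rewrite in_itv.
  rewrite mule1 lee_fin /logit_integrand ler_pdivrMr ?one_expR_gt0// ler_peMr ?expR_ge0//.
  by rewrite lerDl expR_ge0.
apply: le_trans (leeDl _ (B0 z)).
rewrite -EFinM -mulrA -logit_shift mulrCA [leLHS]EFinM.
by apply: lee_wpmul2l; [rewrite lee_fin logit_integrand_ge0|apply: tail; apply: far; exact: ltW].
exact: mbelow.
Qed.
End tail_asymptotics.

(** * One-step drift of the Lyapunov functions *)

Section power_inequalities.
Context {R : realType}.
Implicit Types a t nu X : R.

(** With 1 + t = e^l this is convexity of the exponential on the segment from 0 to l: the tangent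
    bounds at [l * a] are weighted by [a] and [1 - a]. The case t = -1 is separate because l does
    not exist there. *)
Lemma powR_bernoulli a t : 0 <= a <= 1 -> -1 <= t -> (1 + t) `^ a <= 1 + a * t.
Proof.
move=> /andP[a0 a1]; rewrite le_eqVlt => /predU1P[<-|t1].
  rewrite subrr; have [->|an0] := eqVneq a 0; first by rewrite powRr0 mul0r addr0.
  by rewrite powR0//; lra.
have u0 : 0 < 1 + t by lra.
rewrite -[in leLHS](lnK u0) -expRM; set l := ln (1 + t).
have tE : t = expR l - 1 by rewrite lnK// addrAC subrr add0r.
rewrite tE; have e0 := expR_gt0 (l * a).
have h1 : expR (l * a) * (1 + (1 - a) * l) <= expR l.
  have -> : expR l = expR (l * a) * expR ((1 - a) * l).
    by rewrite -expRD; congr expR; ring.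
  by rewrite ler_pM2l// expR_ge1Dx.
have h2 : expR (l * a) * (1 - l * a) <= 1.
  rewrite -[leRHS](expRxMexpNx_1 (l * a)) ler_pM2l//.
  exact: expR_ge1Dx.
have h3 : a * (expR (l * a) * (1 + (1 - a) * l)) <= a * expR l by exact: ler_wpM2l.
have h4 : (1 - a) * (expR (l * a) * (1 - l * a)) <= (1 - a) * 1 by apply: ler_wpM2l => //; lra.
lra.
Qed.

Lemma log_defect_ge0 t : 0 <= t -> 0 <= t - ln (1 + t).
Proof. by move=> t0; rewrite subr_ge0 le_ln1Dx//; lra. Qed.

(** The factor nu (1 + nu) matches the second-order terms at t = 0, and divided by nu it tends to 1
    with nu, so the transience threshold is not shifted. In l = ln (1 + t) the difference has a
    derivative that is nonnegative by two tangent bounds. *)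
Lemma powRN_defect_pos nu t : 0 <= nu -> 0 <= t ->
  (1 + t) `^ (- nu) - 1 + nu * t <= nu * (1 + nu) * (t - ln (1 + t)).
Proof.
move=> n0 t0; have u0 : 0 < 1 + t by lra.
have tE : t = expR (ln (1 + t)) - 1 by rewrite lnK// addrAC subrr add0r.
rewrite -[in X in X - 1](lnK u0) -expRM; set l := ln (1 + t).
rewrite [in X in nu * X]tE [X in X - l]tE -/l -subr_ge0.
have l0 : 0 <= l by apply: ln_ge0; lra.
apply: (@derive_ge0_ge0 R (fun l => nu * (1 + nu) * (expR l - 1 - l) -
   (expR (l * - nu) - 1 + nu * (expR l - 1)))
  (fun l => nu * (nu * expR l - (1 + nu) + expR (l * - nu)))) => // [y _|y y0|].
- have d1 : is_derive y 1 (fun l => expR (l * - nu)) (- nu * expR (y * - nu)).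
    have -> : (fun l : R => expR (l * - nu)) = (fun l => expR (- nu * l)).
      by apply/funext => z; rewrite mulrC.
    by rewrite (mulrC y); exact: is_derive_expRM.
  by apply: is_derive_eq; rewrite /GRing.scale/=; ring.
- apply: mulr_ge0 => //; have e1 := expR_ge1Dx y; have e2 := expR_ge1Dx (y * - nu).
  have : nu * (1 + y) <= nu * expR y by exact: ler_wpM2l.
  lra.
- by rewrite mul0r expR0; lra.
Qed.

(** For -t <= 1/2, Bernoulli applied to the reciprocal leaves a quadratic error, which is at most
    twice (-t)^b. For larger jumps only 1 + t >= 1 / X is available: the power is at most X^nu, and
    4 (-t)^b >= 1 because b <= 2. *)
Lemma powRN_defect_neg nu t X b : 0 < nu <= 1 -> 1 <= X -> 0 < b <= 2 ->
  X^-1 <= 1 + t -> t <= 0 ->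
  (1 + t) `^ (- nu) - 1 + nu * t <= 4 * X `^ nu * (- t) `^ b.
Proof.
move=> /andP[n0 n1] X1 /andP[b0 b2] Xt t0.
have X0 : 0 < X by lra.
have u0 : 0 < 1 + t by apply: lt_le_trans Xt; rewrite invr_gt0.
have Xnu : 1 <= X `^ nu by rewrite -(powRr0 X); apply: ler_powR => //; exact: ltW.
set r := - t; have tE : t = - r by rewrite opprK.
have r0 : 0 <= r by rewrite oppr_ge0.
have rb0 : 0 <= r `^ b by exact: powR_ge0.
have [r12|r12] := leP r (1 / 2).
  have q : (1 + t) `^ (- nu) <= 1 + nu * (r / (1 - r)).
    rewrite powRN -powR_inv1 ?powR_ge0// -powRrM mulrC powRrM powR_inv1; last exact: ltW.
    rewrite (_ : (1 + t)^-1 = 1 + r / (1 - r)); last first.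
      by rewrite tE; field; rewrite gt_eqF//; lra.
    apply: powR_bernoulli; first by rewrite ltW.
    by apply: (@le_trans _ _ 0); [lra|apply: divr_ge0 => //; lra].
  have q2 : r / (1 - r) - r <= 2 * (r * r).
    rewrite (_ : r / (1 - r) - r = r * r / (1 - r)); last by field; rewrite gt_eqF//; lra.
    rewrite ler_pdivrMr; last lra.
    have := mulr_ge0 r0 r0; nra.
  have q3 : r * r <= r `^ b.
    have [->|rn0] := eqVneq r 0; first by rewrite mulr0 powR_ge0.
    rewrite -expr2 -powR_mulrn//; apply: ger_powR => //.
    by rewrite lt_neqAle eq_sym rn0 r0/=; lra.
  have q4 : nu * (r / (1 - r) - r) <= 1 * (2 * r `^ b).
    apply: ler_pM => //; [exact: ltW| |lra].
    rewrite (_ : r / (1 - r) - r = r * r / (1 - r)); last by field; rewrite gt_eqF//; lra.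
    by apply: divr_ge0; [exact: mulr_ge0|lra].
  have q5 : 1 * r `^ b <= X `^ nu * r `^ b by exact: ler_wpM2r.
  rewrite -mulrA; rewrite tE in q *; lra.
have q1 : (1 + t) `^ (- nu) <= X `^ nu.
  rewrite powRN -(invrK (X `^ nu)) lef_pV2 ?posrE ?invr_gt0 ?powR_gt0//.
  rewrite -powRN -powR_inv1 ?(ltW X0)// in Xt *.
  rewrite -(mulN1r nu) powRrM; apply: ge0_ler_powR => //; first exact: ltW.
    by rewrite nnegrE powR_ge0.
  by rewrite nnegrE ltW.
have q2 : 1 <= 4 * r `^ b.
  have e : 4^-1 = (1 / 2 : R) `^ 2 by rewrite powR_mulrn; lra.
  have : (1 / 2 : R) `^ 2 <= (1 / 2 : R) `^ b by apply: ger_powR => //; lra.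
  have : (1 / 2 : R) `^ b <= r `^ b.
    by apply: ge0_ler_powR; rewrite ?nnegrE ?(ltW b0) ?(ltW r12)//; lra.
  rewrite -e; lra.
have q3 : X `^ nu * 1 <= X `^ nu * (4 * r `^ b) by apply: ler_wpM2l => //; lra.
have q4 : nu * t <= 0 by rewrite mulr_ge0_le0// ltW.
lra.
Qed.

(** For |t| <= 1, Bernoulli with exponent p - 1, multiplied by 1 + t, leaves (p - 1) t^2. Otherwise
    t > 1, and (1 + t)^p <= (2 t)^p <= 4 t^a. *)
Lemma powR_defect p a t : 1 <= p -> p < a -> a < 2 -> -1 <= t ->
  (1 + t) `^ p - 1 - p * t <= 4 * `|t| `^ a.
Proof.
move=> p1 pa a2 t1.
have a0 : 0 < a by lra.
have [tle|tgt] := leP `|t| 1.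
  have u0 : 0 <= 1 + t by lra.
  have q1 : (1 + t) `^ p <= (1 + t) * (1 + (p - 1) * t).
    rewrite -mulr_powRB1//; last lra.
    by apply: ler_wpM2l => //; apply: powR_bernoulli => //; lra.
  have q2 : t * t <= `|t| `^ a.
    have [->|tn0] := eqVneq t 0; first by rewrite mulr0 powR_ge0.
    rewrite -expr2 -real_normK ?num_real// -powR_mulrn//; apply: ger_powR; last exact: ltW.
    by rewrite normr_gt0 tn0.
  have q3 : (p - 1) * (t * t) <= 1 * (t * t).
    by apply: ler_wpM2r; [rewrite -expr2 sqr_ge0|lra].
  have q4 : 0 <= t * t by rewrite -expr2 sqr_ge0.
  lra.
have t1' : 1 < t by move: tgt; rewrite ltr_normr => /orP[]; lra.
have t0 : 0 < t by lra.
rewrite gtr0_norm//.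
have q1 : (1 + t) `^ p <= (2 * t) `^ p by apply: ge0_ler_powR; rewrite ?nnegrE; lra.
have q2 : (2 : R) `^ p <= 4.
  rewrite (_ : 4 = (2 : R) `^ 2); last by rewrite powR_mulrn//; lra.
  by apply: ler_powR; lra.
have q3 : t `^ p <= t `^ a by apply: ler_powR; lra.
rewrite powRM in q1; [|lra|lra].
have q4 : (2 : R) `^ p * t `^ p <= 4 * t `^ a by apply: ler_pM => //; exact: powR_ge0.
have : 0 <= p * t by rewrite mulr_ge0//; lra.
lra.
Qed.
End power_inequalities.

(** * Expectations of the two parts of an increment *)

Section increments.
Context {R : realType} {d : measure_display} {T : measurableType d}.
Implicit Types (Q : probability T R) (u v a b g h V : T -> R).

Lemma pospart_ge0 (y : R) : 0 <= pospart y.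
Proof. by rewrite /pospart; case: ifP. Qed.

Lemma negpart_ge0 (y : R) : 0 <= negpart y.
Proof. by rewrite /negpart; case: ifP => // y0; rewrite oppr_ge0 ltW. Qed.

Lemma pospartE (y : R) : pospart y = Num.max y 0.
Proof. by rewrite /pospart; case: leP. Qed.

Lemma negpartE (y : R) : negpart y = Num.max (- y) 0.
Proof. by rewrite /negpart -oppr_gt0; case: (ltP 0 (- y)). Qed.

Lemma measurable_pospart V : measurable_fun setT V -> measurable_fun setT (fun w => pospart (V w)).
Proof.
by move=> mV; under eq_fun do rewrite pospartE; apply: measurable_maxr.
Qed.

Lemma measurable_negpart V : measurable_fun setT V -> measurable_fun setT (fun w => negpart (V w)).
Proof.
move=> mV; under eq_fun do rewrite negpartE.
by apply: measurable_maxr => //; exact: measurableT_comp.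
Qed.

Lemma integral_parts Q V : measurable_fun setT V ->
  (\int[Q]_w (V w)%:E = \int[Q]_w (pospart (V w))%:E - \int[Q]_w (negpart (V w))%:E)%E.
Proof.
move=> mV; rewrite integralE; congr (_ - _)%E; apply: eq_integral => w _.
  by rewrite funeposE /= pospartE EFin_max.
by rewrite funenegE /= negpartE EFin_max EFinN.
Qed.

(** A common form for all drift estimates: [u] is the Lyapunov function after one step, [a] and [b]
    are the two parts of theta, [g] a gain and [h] an error. Every term is nonnegative and stays on
    its own side, so integrating needs no integrability. *)
Lemma le_integral_ae_combination Q u a b g h (k C p m : R) :
  measurable_fun setT u -> measurable_fun setT a -> measurable_fun setT b ->
  measurable_fun setT g -> measurable_fun setT h ->
  (forall w, 0 <= u w) -> (forall w, 0 <= a w) -> (forall w, 0 <= b w) ->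
  (forall w, 0 <= g w) -> (forall w, 0 <= h w) -> 0 <= k -> 0 <= C ->
  (\forall w \ae Q, u w + k * a w + g w <= C + k * b w + h w) ->
  (\int[Q]_w (a w)%:E = p%:E)%E -> (\int[Q]_w (b w)%:E = m%:E)%E ->
  (\int[Q]_w (u w)%:E + (k * p)%:E + \int[Q]_w (g w)%:E
    <= (C + k * m)%:E + \int[Q]_w (h w)%:E)%E.
Proof.
move=> mu ma mb mg mh u0 a0 b0 g0 h0 k0 C0 le Ea Eb.
have ka0 w : 0 <= k * a w by rewrite mulr_ge0.
have kb0 w : 0 <= k * b w by rewrite mulr_ge0.
have mka : measurable_fun setT (fun w => k * a w) by exact: measurable_funM.
have mkb : measurable_fun setT (fun w => k * b w) by exact: measurable_funM.
have Eka : (\int[Q]_w (k * a w)%:E = (k * p)%:E)%E.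
  under eq_integral do rewrite EFinM.
  rewrite ge0_integralZl_EFin// ?Ea//; first by move=> w _; rewrite lee_fin.
  exact/measurable_EFinP.
have Ekb : (\int[Q]_w (k * b w)%:E = (k * m)%:E)%E.
  under eq_integral do rewrite EFinM.
  rewrite ge0_integralZl_EFin// ?Eb//; first by move=> w _; rewrite lee_fin.
  exact/measurable_EFinP.
have D (f1 f2 : T -> R) : measurable_fun setT f1 -> measurable_fun setT f2 ->
    (forall w, 0 <= f1 w) -> (forall w, 0 <= f2 w) ->
    (\int[Q]_w (f1 w + f2 w)%:E = \int[Q]_w (f1 w)%:E + \int[Q]_w (f2 w)%:E)%E.
  move=> m1 m2 f10 f20; under eq_integral do rewrite EFinD.
  by rewrite ge0_integralD//; [move=> w _; rewrite lee_fin|exact/measurable_EFinP|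
    move=> w _; rewrite lee_fin|exact/measurable_EFinP].
have EC : (\int[Q]_w (C%:E : \bar R) = C%:E)%E.
  by rewrite integral_cst// [X in (_ * X)%E]probability_setT mule1.
rewrite -Eka -D// -D//; [|exact: measurable_funD|by move=> w; exact: addr_ge0].
rewrite EFinD -Ekb -{1}EC -D// -D//; [|exact: measurable_funD|by move=> w; exact: addr_ge0].
apply: ae_ge0_le_integral => //.
- by move=> w _; rewrite lee_fin !addr_ge0.
- by apply/measurable_EFinP; apply: measurable_funD => //; exact: measurable_funD.
- by move=> w _; rewrite lee_fin !addr_ge0.
- by apply/measurable_EFinP; apply: measurable_funD => //; exact: measurable_funD.
- by apply: filterS le => w + _; rewrite lee_fin.
Qed.

(** Delivers the integral as a real number; the finiteness of the means of theta_+ and theta_- is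
    obtained in this way. *)
Lemma integral_le_affine Q u v (C k B : R) : 0 <= C -> 0 <= k ->
  measurable_fun setT u -> measurable_fun setT v ->
  (forall w, 0 <= u w) -> (forall w, 0 <= v w) ->
  (forall w, u w <= C + k * v w) -> (\int[Q]_w (v w)%:E <= B%:E)%E ->
  exists p : R, [/\ (\int[Q]_w (u w)%:E = p%:E)%E, 0 <= p & p <= C + k * B].
Proof.
move=> C0 k0 mu mv u0 v0 uv vB.
have v0' : (0 <= \int[Q]_w (v w)%:E)%E by apply: integral_ge0 => w _; rewrite lee_fin.
have vfin : (\int[Q]_w (v w)%:E)%E \is a fin_num.
  by rewrite ge0_fin_numE//; apply: le_lt_trans vB (ltry _).
have E0 : (\int[Q]_w (0 : R)%:E = 0%:E)%E by exact: integral0.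
have := @le_integral_ae_combination Q u (fun=> 0) v (fun=> 0) (fun=> 0) k C 0
  (fine (\int[Q]_w (v w)%:E)%E) mu (@measurable_cst _ _ _ _ _ _) mv
  (@measurable_cst _ _ _ _ _ _) (@measurable_cst _ _ _ _ _ _) u0 (fun=> lexx _) v0
  (fun=> lexx _) (fun=> lexx _) k0 C0 _ E0 _.
rewrite fineK// E0 mulr0 !adde0 => /(_ _ erefl) H.
have {H} le1 : (\int[Q]_w (u w)%:E <= (C + k * fine (\int[Q]_w (v w)%:E))%:E)%E.
  by apply: H; apply: aeW => w /=; rewrite ?mulr0 !addr0.
have u0' : (0 <= \int[Q]_w (u w)%:E)%E by apply: integral_ge0 => w _; rewrite lee_fin.
have ufin : (\int[Q]_w (u w)%:E)%E \is a fin_num.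
  by rewrite ge0_fin_numE//; apply: le_lt_trans le1 (ltry _).
exists (fine (\int[Q]_w (u w)%:E)%E); rewrite fineK//; split=> //.
  by rewrite fine_ge0.
rewrite -lee_fin fineK//; apply: le_trans le1 _; rewrite lee_fin lerD2l.
by apply: ler_wpM2l => //; rewrite -lee_fin fineK.
Qed.
End increments.

Section limits_at_infinity.
Context {R : realType}.

Lemma limf_esup_ltP (X : set R) (F : R -> \bar R) (l : \bar R) :
  (limf_esup F (within X (@pinfty_nbhs R)) < l)%E ->
  exists M (s : \bar R), (s < l)%E /\ forall x, X x -> M < x -> (F x <= s)%E.
Proof.
move=> /ereal_inf_lt[_ [V VX <-] Vl].
have [M [_ MV]] := VX; exists M, (ereal_sup (F @` V)); split=> // x Xx Mx.
by apply: ereal_sup_ubound; exists x => //; exact: MV.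
Qed.

Lemma powRN_small (s e : R) : 0 < s -> 0 < e ->
  exists2 M, 0 < M & forall x, M < x -> x `^ (- s) <= e.
Proof.
move=> s0 e0; have M0 : 0 < e^-1 `^ s^-1 by rewrite powR_gt0// invr_gt0.
exists (e^-1 `^ s^-1) => // x Mx.
have x0 : 0 < x by exact: lt_trans Mx.
rewrite powRN -(invrK e) lef_pV2 ?posrE ?powR_gt0 ?invr_gt0//.
have -> : e^-1 = (e^-1 `^ s^-1) `^ s.
  by rewrite -powRrM mulVf ?gt_eqF// powRr1// invr_ge0 ltW.
by apply: ge0_ler_powR; rewrite ?nnegrE ?ltW.
Qed.

End limits_at_infinity.

(** * Pointwise inequalities for one step *)

Section one_step_bounds.
Context {R : realType}.
Implicit Types x y nu q a b : R.

Lemma pospart_id y : 0 <= y -> pospart y = y.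
Proof. by rewrite /pospart => ->. Qed.

Lemma pospart_neg y : y < 0 -> pospart y = 0.
Proof. by rewrite /pospart ltNge => /negbTE ->. Qed.

Lemma negpart_neg y : y < 0 -> negpart y = - y.
Proof. by rewrite /negpart => ->. Qed.

Lemma negpart_pos y : 0 <= y -> negpart y = 0.
Proof. by rewrite /negpart leNgt => /negbTE ->. Qed.

Lemma pospartB y : pospart y - negpart y = y.
Proof.
have [y0|y0] := leP 0 y; first by rewrite pospart_id// negpart_pos// subr0.
by rewrite pospart_neg// negpart_neg// sub0r opprK.
Qed.

Lemma power_step q a x y : 1 <= q -> q < a -> a < 2 -> 0 < x -> 0 <= y ->
  y `^ q <= x `^ q + q * x `^ (q - 1) * (y - x) + 4 * x `^ (q - a) * `|y - x| `^ a.
Proof.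
move=> q1 qa a2 x0 y0; have xn0 : x != 0 by rewrite gt_eqF.
set t := (y - x) / x.
have tE : y = x * (1 + t) by rewrite /t; field.
have t1 : 0 <= 1 + t by rewrite -(pmulr_rge0 _ x0) -tE.
have h : (1 + t) `^ q - 1 - q * t <= 4 * `|t| `^ a by apply: powR_defect => //; lra.
have yx : y - x = x * t by rewrite {1}tE; ring.
have -> : y `^ q = x `^ q * (1 + t) `^ q by rewrite {1}tE powRM// ltW.
have -> : q * x `^ (q - 1) * (y - x) = x `^ q * (q * t).
  rewrite yx -(@mulr_powRB1 _ x q) ?(ltW x0)//; last lra.
  by ring.
have -> : 4 * x `^ (q - a) * `|y - x| `^ a = x `^ q * (4 * `|t| `^ a).
  rewrite yx normrM gtr0_norm// powRM ?(ltW x0)// powRB ?xn0 ?implybT//.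
  by field; rewrite gt_eqF// powR_gt0.
rewrite -[X in _ <= X + _ + _]mulr1 -!mulrDr ler_pM2l ?powR_gt0//; lra.
Qed.

(** For an upward step this is an equality, so the defect enters at its exact size. For a downward
    step ln (1 + t) <= t suffices, since only an upper bound is wanted. *)
Lemma log_step x y : 0 <= x -> 0 <= y ->
  ln (1 + y) + (1 + x)^-1 * negpart (y - x)
    + (pospart (y - x) / (1 + x) - ln (1 + pospart (y - x) / (1 + x)))
  <= ln (1 + x) + (1 + x)^-1 * pospart (y - x).
Proof.
move=> x0 y0; have X0 : 0 < 1 + x by lra.
set t := (y - x) / (1 + x).
have tE : 1 + y = (1 + x) * (1 + t) by rewrite /t; field; rewrite gt_eqF.
have t1 : 0 < 1 + t by rewrite -(pmulr_rgt0 _ X0) -tE; lra.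
rewrite tE lnM ?posrE//.
have [yx|yx] := leP 0 (y - x).
  by rewrite negpart_pos// pospart_id// -/t mulr0 [_^-1 * _]mulrC -/t; lra.
rewrite negpart_neg// pospart_neg// mul0r addr0 ln1 mulr0 mulrN [_^-1 * _]mulrC -/t.
have : ln (1 + t) <= t by apply: le_ln1Dx; lra.
lra.
Qed.

(** After division by (1 + x)^-nu the two directions are the two defect lemmas. The bound 1 + t >= 1
    / X required downward is nonnegativity of [y]. *)
Lemma negpow_step nu b x y : 0 < nu <= 1 -> 0 < b <= 2 -> 0 <= x -> 0 <= y ->
  (1 + y) `^ (- nu) + (1 + x) `^ (- nu) * nu / (1 + x) * pospart (y - x)
  <= (1 + x) `^ (- nu) + (1 + x) `^ (- nu) * nu / (1 + x) * negpart (y - x)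
    + ((1 + x) `^ (- nu) * (nu * (1 + nu)) *
        (pospart (y - x) / (1 + x) - ln (1 + pospart (y - x) / (1 + x)))
     + (1 + x) `^ (- nu) * (4 * (1 + x) `^ (nu - b)) * negpart (y - x) `^ b).
Proof.
move=> nu01 b02 x0 y0; have X0 : 0 < 1 + x by lra.
have /andP[nu0 nu1] := nu01; have /andP[b0 _] := b02.
set X := 1 + x in X0 *; set t := (y - x) / X.
have tE : 1 + y = X * (1 + t) by rewrite /t /X; field; rewrite gt_eqF.
have t1 : 0 < 1 + t by rewrite -(pmulr_rgt0 _ X0) -tE; lra.
rewrite tE powRM ?(ltW X0) ?(ltW t1)//.
have c0 : 0 < X `^ (- nu) by rewrite powR_gt0.
have [yx|yx] := leP 0 (y - x).
  have t0 : 0 <= t by rewrite divr_ge0// ltW.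
  rewrite negpart_pos// pospart_id// -/t powR0 ?gt_eqF// !mulr0 !addr0.
  have h := powRN_defect_pos nu t (ltW nu0) t0.
  rewrite (_ : X `^ (- nu) * nu / X * (y - x) = X `^ (- nu) * (nu * t)); last first.
    by rewrite /t; ring.
  have h' := ler_wpM2l (ltW c0) h; lra.
rewrite pospart_neg// negpart_neg// mul0r addr0 ln1 subr0 !mulr0 addr0 add0r.
have t0 : t <= 0 by rewrite /t pmulr_lle0 ?invr_gt0// ltW.
have Xt : X^-1 <= 1 + t.
  by rewrite -(ler_pM2l X0) -tE mulfV ?gt_eqF//; lra.
have X1 : 1 <= X by rewrite /X; lra.
have h := powRN_defect_neg nu t X b nu01 X1 b02 Xt t0.
have -> : X `^ (- nu) * nu / X * - (y - x) = X `^ (- nu) * (- (nu * t)).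
  by rewrite /t; ring.
have -> : X `^ (- nu) * (4 * X `^ (nu - b)) * (- (y - x)) `^ b
    = X `^ (- nu) * (4 * X `^ nu * (- t) `^ b).
  have -> : - (y - x) = X * (- t) by rewrite /t; field; rewrite gt_eqF.
  rewrite powRM ?(ltW X0) ?oppr_ge0// powRB ?(gt_eqF X0) ?implybT//.
  by field; rewrite gt_eqF// powR_gt0.
have h' := ler_wpM2l (ltW c0) h; lra.
Qed.
End one_step_bounds.

(** * Expected one-step change of the Lyapunov functions *)

Section drift_bounds.
Context {R : realType} {d : measure_display} {Om : measurableType d}.
Context {X : set R} {P : R -> probability Om R} {xi : nat -> Om -> R}.
Hypothesis mX : measurable X.
Hypothesis X0 : forall x, X x -> 0 <= x.
Hypothesis chain : markov_chain X P xi.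

Let mpow (V : Om -> R) a : measurable_fun setT V -> measurable_fun setT (fun w => V w `^ a).
Proof. exact: (measurableT_comp (measurable_powR a)). Qed.

Let mln (V : Om -> R) : measurable_fun setT V -> measurable_fun setT (fun w => ln (V w)).
Proof. exact: (measurableT_comp (@measurable_ln R)). Qed.

Let mxi n : measurable_fun setT (xi n).
Proof. by case: chain. Qed.

Lemma measurable_theta : measurable_fun setT (theta xi).
Proof. exact: measurable_funB. Qed.

(** Removes the absolute value in [|xi 1 w|], by which the Lyapunov functions are extended from the
    half-line to the whole line. *)
Lemma step_ae x : X x -> \forall w \ae P x, theta xi w = xi 1 w - x /\ 0 <= xi 1 w.
Proof.
move=> Xx; have h1 := chain_start_ae chain x Xx; have h2 := chain_in_ae mX chain x 1 Xx.
by apply: filterS2 h1 h2 => w h /X0; rewrite /theta h.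
Qed.

Let mpos : measurable_fun setT (fun w => pospart (theta xi w)).
Proof. by apply: measurable_pospart; exact: measurable_theta. Qed.

Let mneg : measurable_fun setT (fun w => negpart (theta xi w)).
Proof. by apply: measurable_negpart; exact: measurable_theta. Qed.

Let mphi c : measurable_fun setT
  (fun w => pospart (theta xi w) / c - ln (1 + pospart (theta xi w) / c)).
Proof.
apply: measurable_funB; first exact: measurable_funM.
by apply: mln; apply: measurable_funD => //; exact: measurable_funM.
Qed.

Let phi_ge0 c w : 0 < c ->
  0 <= pospart (theta xi w) / c - ln (1 + pospart (theta xi w) / c).
Proof. by move=> c0; apply: log_defect_ge0; rewrite divr_ge0 ?pospart_ge0// ltW. Qed.

Lemma power_drift x q a p m K : X x -> 0 < x -> 1 <= q -> q < a -> a < 2 ->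
  (\int[P x]_w (pospart (theta xi w))%:E = p%:E)%E ->
  (\int[P x]_w (negpart (theta xi w))%:E = m%:E)%E ->
  (\int[P x]_w (`|theta xi w| `^ a)%:E <= K%:E)%E ->
  (\int[P x]_w (`|xi 1 w| `^ q)%:E <=
    (x `^ q + q * x `^ (q - 1) * (p - m) + 4 * x `^ (q - a) * K)%:E)%E.
Proof.
move=> Xx x0 q1 qa a2 Ep Em EK.
have c0 : 0 <= 4 * x `^ (q - a) by rewrite mulr_ge0// powR_ge0.
have mabs : measurable_fun setT (fun w => `|theta xi w| `^ a).
  by apply: mpow; apply: measurableT_comp => //; exact: measurable_theta.
have := @le_integral_ae_combination _ _ _ (P x) (fun w => `|xi 1 w| `^ q)
  (fun w => negpart (theta xi w)) (fun w => pospart (theta xi w)) (fun=> 0)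
  (fun w => 4 * x `^ (q - a) * `|theta xi w| `^ a) (q * x `^ (q - 1)) (x `^ q) m p.
rewrite integral0 adde0 => /(_ _ mneg mpos (measurable_cst _) _ _ _ _ _ _ _ _ _ Em Ep) H.
have E4 : (\int[P x]_w (4 * x `^ (q - a) * `|theta xi w| `^ a)%:E
    <= (4 * x `^ (q - a) * K)%:E)%E.
  under eq_integral do rewrite EFinM.
  rewrite ge0_integralZl_EFin//; last exact/measurable_EFinP.
  by rewrite [leRHS]EFinM; apply: lee_wpmul2l => //; rewrite lee_fin.
have {}H : (\int[P x]_w (`|xi 1 w| `^ q)%:E + (q * x `^ (q - 1) * m)%:E <=
    (x `^ q + q * x `^ (q - 1) * p)%:E +
    \int[P x]_w (4 * x `^ (q - a) * `|theta xi w| `^ a)%:E)%E.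
  apply: H => //; try first [
    solve [by apply: mpow; exact: measurableT_comp]
    | solve [by exact: measurable_funM]
    | solve [by move=> w; exact: powR_ge0]
    | solve [by move=> w; exact: negpart_ge0]
    | solve [by move=> w; exact: pospart_ge0]
    | solve [by move=> w; rewrite mulr_ge0// powR_ge0]
    | solve [by rewrite mulr_ge0 ?powR_ge0//; lra]
    | solve [by exact: powR_ge0]].
  apply: filterS (step_ae x Xx) => w [thE xi0].
  have := power_step q a x (xi 1 w) q1 qa a2 x0 xi0.
  rewrite -thE [`|xi 1 w|]ger0_norm// (_ : q * x `^ (q - 1) * theta xi w = q * x `^ (q - 1) * pospart (theta xi w)
    - q * x `^ (q - 1) * negpart (theta xi w)); last by rewrite -mulrBr pospartB.
  by lra.
have := le_trans H (leeD2l _ E4).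
rewrite -EFinD -leeBrDr// => /le_trans; apply.
by rewrite -EFinB lee_fin; lra.
Qed.

Lemma log_drift x p m e : X x ->
  (\int[P x]_w (pospart (theta xi w))%:E = p%:E)%E ->
  (\int[P x]_w (negpart (theta xi w))%:E = m%:E)%E ->
  (\int[P x]_w (pospart (theta xi w) / (1 + x) - ln (1 + pospart (theta xi w) / (1 + x)))%:E = e%:E)%E ->
  (\int[P x]_w (ln (1 + `|xi 1 w|))%:E <= (ln (1 + x) + (p - m) / (1 + x) - e)%:E)%E.
Proof.
move=> Xx Ep Em Ee; have x0 : 0 <= x :> R by exact: X0.
have c0 : 0 < 1 + x by rewrite ltr_pwDl.
have := @le_integral_ae_combination _ _ _ (P x) (fun w => ln (1 + `|xi 1 w|))
  (fun w => negpart (theta xi w)) (fun w => pospart (theta xi w))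
  (fun w => pospart (theta xi w) / (1 + x) - ln (1 + pospart (theta xi w) / (1 + x)))
  (fun=> 0) (1 + x)^-1 (ln (1 + x)) m p.
rewrite integral0 adde0 Ee => /(_ _ mneg mpos (mphi _) (measurable_cst _) _ _ _ _ _ _ _ _ Em Ep) H.
have {}H : (\int[P x]_w (ln (1 + `|xi 1 w|))%:E + ((1 + x)^-1 * m)%:E + e%:E <=
    (ln (1 + x) + (1 + x)^-1 * p)%:E)%E.
  apply: H => //; try first [
    solve [by apply: mln; apply: measurable_funD => //; exact: measurableT_comp]
    | solve [by move=> w; apply: ln_ge0; rewrite lerDl]
    | solve [by move=> w; exact: negpart_ge0]
    | solve [by move=> w; exact: pospart_ge0]
    | solve [by move=> w; exact: phi_ge0]
    | solve [by rewrite invr_ge0 ltW]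
    | solve [by apply: ln_ge0; rewrite lerDl]].
  apply: filterS (step_ae x Xx) => w [thE xi0].
  by have := log_step x (xi 1 w) x0 xi0; rewrite -thE [`|xi 1 w|]ger0_norm// addr0.
move: H; rewrite -leeBrDr// -leeBrDr// => /le_trans; apply.
by rewrite -!EFinB lee_fin; lra.
Qed.

Lemma negpow_drift x nu b p m e N : X x -> 0 < nu <= 1 -> 0 < b <= 2 ->
  (\int[P x]_w (pospart (theta xi w))%:E = p%:E)%E ->
  (\int[P x]_w (negpart (theta xi w))%:E = m%:E)%E ->
  (\int[P x]_w (pospart (theta xi w) / (1 + x) - ln (1 + pospart (theta xi w) / (1 + x)))%:E <= e%:E)%E ->
  (\int[P x]_w (negpart (theta xi w) `^ b)%:E <= N%:E)%E ->
  (\int[P x]_w ((1 + `|xi 1 w|) `^ (- nu))%:E <= ((1 + x) `^ (- nu) *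
     (1 - nu * ((p - m) / (1 + x)) + nu * (1 + nu) * e + 4 * (1 + x) `^ (nu - b) * N))%:E)%E.
Proof.
move=> Xx nu01 b02 Ep Em Ee EN; have x0 : 0 <= x :> R by exact: X0.
have c0 : 0 < 1 + x by rewrite ltr_pwDl.
have /andP[nu0 nu1] := nu01.
set k2 := (1 + x) `^ (- nu) * (nu * (1 + nu)).
set k3 := (1 + x) `^ (- nu) * (4 * (1 + x) `^ (nu - b)).
have k20 : 0 <= k2 by rewrite !mulr_ge0 ?powR_ge0//; lra.
have k30 : 0 <= k3 by rewrite !mulr_ge0 ?powR_ge0.
pose phi w := pospart (theta xi w) / (1 + x) - ln (1 + pospart (theta xi w) / (1 + x)).
pose h w := k2 * phi w + k3 * negpart (theta xi w) `^ b.
have mnb : measurable_fun setT (fun w => negpart (theta xi w) `^ b).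
  exact: mpow.
have phi0 w : 0 <= phi w by exact: phi_ge0.
have := @le_integral_ae_combination _ _ _ (P x) (fun w => (1 + `|xi 1 w|) `^ (- nu))
  (fun w => pospart (theta xi w)) (fun w => negpart (theta xi w))
  (fun=> 0) h ((1 + x) `^ (- nu) * nu / (1 + x)) ((1 + x) `^ (- nu)) p m.
rewrite integral0 adde0 => /(_ _ mpos mneg (measurable_cst _) _ _ _ _ _ _ _ _ _ Ep Em) H.
have E4 : (\int[P x]_w (h w)%:E <= (k2 * e + k3 * N)%:E)%E.
  rewrite (eq_integral (fun w => k2%:E * (phi w)%:E +
      k3%:E * (negpart (theta xi w) `^ b)%:E)%E); last first.
    by move=> w _; rewrite -!EFinM -EFinD.
  have mphi' : measurable_fun setT (fun w => (phi w)%:E).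
    by apply/measurable_EFinP; exact: mphi.
  have mnb' : measurable_fun setT (fun w => (negpart (theta xi w) `^ b)%:E).
    exact/measurable_EFinP.
  rewrite ge0_integralD//; [|by move=> w _; rewrite -EFinM lee_fin mulr_ge0|
    exact: emeasurable_funM|by move=> w _; rewrite -EFinM lee_fin mulr_ge0// powR_ge0|
    exact: emeasurable_funM].
  have phi0' w : [set: Om] w -> (0 <= (phi w)%:E)%E by move=> _; rewrite lee_fin.
  have nb0' w : [set: Om] w -> (0 <= (negpart (theta xi w) `^ b)%:E)%E.
    by move=> _; rewrite lee_fin powR_ge0.
  rewrite !ge0_integralZl_EFin//.
  rewrite [leRHS](_ : _ = (k2%:E * e%:E + k3%:E * N%:E)%E); last by rewrite -!EFinM -EFinD.
  by apply: leeD; apply: lee_wpmul2l => //; rewrite lee_fin.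
have {}H : (\int[P x]_w ((1 + `|xi 1 w|) `^ (- nu))%:E + ((1 + x) `^ (- nu) * nu / (1 + x) * p)%:E <=
    ((1 + x) `^ (- nu) + (1 + x) `^ (- nu) * nu / (1 + x) * m)%:E + \int[P x]_w (h w)%:E)%E.
  apply: H => //; try first [
    solve [by apply: mpow; apply: measurable_funD => //; exact: measurableT_comp]
    | solve [by apply: measurable_funD; [apply: measurable_funM => //; exact: mphi|exact: measurable_funM]]
    | solve [by move=> w; exact: powR_ge0]
    | solve [by move=> w; exact: pospart_ge0]
    | solve [by move=> w; exact: negpart_ge0]
    | solve [by move=> w; rewrite addr_ge0// mulr_ge0// powR_ge0]
    | solve [by rewrite !mulr_ge0 ?powR_ge0 ?invr_ge0//; lra]
    | solve [by exact: powR_ge0]].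
  apply: filterS (step_ae x Xx) => w [thE xi0].
  have := negpow_step nu b x (xi 1 w) nu01 b02 x0 xi0.
  by rewrite -thE [`|xi 1 w|]ger0_norm// addr0.
have := le_trans H (leeD2l _ E4).
rewrite -EFinD -leeBrDr// => /le_trans; apply.
by rewrite -EFinB lee_fin /k2 /k3; lra.
Qed.
End drift_bounds.

(** * Classification *)

Section tail_condition.
Context {R : realType} {d : measure_display} {Om : measurableType d}.
Context {X : set R} {P : R -> probability Om R} {xi : nat -> Om -> R}.
Hypothesis chain : markov_chain X P xi.

Lemma drift_fin x p m :
  (\int[P x]_w (pospart (theta xi w))%:E = p%:E)%E ->
  (\int[P x]_w (negpart (theta xi w))%:E = m%:E)%E -> drift P xi x = (p - m)%:E.
Proof.
move=> Ep Em; rewrite /drift integral_parts; last exact: (measurable_theta chain).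
by rewrite Ep Em EFinB.
Qed.

Lemma condT_tail (alpha c x0 eta : R) : 0 < eta ->
  (fun y => ereal_sup [set (`| y `^ alpha *
       fine (P x [set w | pospart (theta xi w) > y]) - c |)%:E
     | x in [set x | X x /\ (x0 <= x)%R]]) @ +oo --> 0%E ->
  exists2 y0, 0 < y0 & forall x, X x -> x0 <= x -> forall y, y0 <= y ->
    (((c - eta) * y `^ (- alpha))%:E <= P x [set w | (y < pospart (theta xi w))%R]
      <= ((c + eta) * y `^ (- alpha))%:E)%E.
Proof.
move=> eta0 hcv.
have nb : nbhs (0%E : \bar R) [set z : \bar R | (z < eta%:E)%E].
  by apply: open_nbhs_nbhs; split; [exact: open_ereal_lt_ereal|rewrite /= lte_fin].
have [M [_ HM]] := hcv _ nb.
exists (Num.max M 0 + 1); first by rewrite ltr_pwDr// le_max lexx orbT.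
move=> x Xx x0x y yM.
have My : M < y by apply: lt_le_trans yM; rewrite ltr_pwDr// le_max lexx.
have y0 : 0 < y by apply: lt_le_trans yM; rewrite ltr_pwDr// le_max lexx orbT.
have mS : measurable [set w | y < pospart (theta xi w)].
  have mpos : measurable_fun setT (fun w => pospart (theta xi w)).
    by apply: measurable_pospart; exact: (measurable_theta chain).
  have := measurable_fun_ltr (@measurable_cst _ _ _ _ setT y) mpos.
  by move=> /(_ measurableT [set true]); rewrite setTI; apply.
have Pfin : P x [set w | y < pospart (theta xi w)] \is a fin_num by exact: fin_num_measure.
have := HM y My => /= hsup.
have : ((`| y `^ alpha * fine (P x [set w | y < pospart (theta xi w)]) - c |)%:E < eta%:E)%E.
  by apply: le_lt_trans hsup; apply: ereal_sup_ubound; exists x.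
have ya : 0 < y `^ alpha by rewrite powR_gt0.
rewrite -(fineK Pfin) !lee_fin lte_fin; set q := fine _ => /ltW.
rewrite ler_norml => /andP[h1 h2].
have g1 : c - eta <= q * y `^ alpha by lra.
have g2 : q * y `^ alpha <= c + eta by lra.
by rewrite powRN ler_pdivrMr// ler_pdivlMr// g1.
Qed.

(** The thresholds and [B] are chosen before the starting point; only the two means [p], [m] and the
    expected defect [e] depend on [x]. *)
Lemma condT_moments (alpha beta c eta : R) : condT X P xi alpha beta c ->
  0 < eta < c -> exists x1 y0 B : R, [/\ 0 <= x1, 0 < y0, 0 <= B &
    forall x, X x -> x1 <= x -> 0 <= x -> exists p m e : R, [/\
      [/\ (\int[P x]_w (pospart (theta xi w))%:E = p%:E)%E,
        (\int[P x]_w (negpart (theta xi w))%:E = m%:E)%E,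
        (\int[P x]_w (pospart (theta xi w) / (1 + x)
            - ln (1 + pospart (theta xi w) / (1 + x)))%:E = e%:E)%E & 0 <= e],
      e <= (y0 / (1 + x)) `^ 2 / 2
        + (c + eta) * (1 + x) `^ (- alpha) * (pi / `|sin (pi * alpha)|),
      (c - eta) * (1 + x) `^ (- alpha) * (pi / `|sin (pi * alpha)|) <= e
        + (c - eta) * (1 + x) `^ (- alpha) * ((y0 / (1 + x)) `^ (2 - alpha) / (2 - alpha)) &
      (\int[P x]_w (negpart (theta xi w) `^ (Num.min beta 2))%:E <= (1 + B)%:E)%E]].
Proof.
move=> [/andP[a1 a2] ab c0 [x1 [x10 [hcv hneg]]]] /andP[eta0 etac].
have [y0 y00 tail] := condT_tail alpha c x1 eta eta0 hcv.
have [B B0 HB] : exists2 B : R, 0 <= B & forall x, X x -> x1 <= x ->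
    (\int[P x]_w (negpart (theta xi w) `^ beta)%:E <= B%:E)%E.
  move: hneg; set S := ereal_sup _ => Soo.
  have [B SB] : exists B : R, (S <= B%:E)%E.
    by case: S Soo => [r _|//|_]; [exists r|exists 0; exact: leNye].
  exists (Num.max B 0); first by rewrite le_max lexx orbT.
  move=> x Xx x1x; apply: (@le_trans _ _ S); first by apply: ereal_sup_ubound; exists x.
  by apply: le_trans SB _; rewrite lee_fin le_max lexx.
exists x1, y0, B; split=> // x Xx x1x x0.
have X0 : 0 < 1 + x by rewrite ltr_pwDl.
have mth := measurable_theta chain.
have mpos : measurable_fun setT (fun w => pospart (theta xi w)) by exact: measurable_pospart.
have mneg : measurable_fun setT (fun w => negpart (theta xi w)) by exact: measurable_negpart.
have mpow b : measurable_fun setT (fun w => negpart (theta xi w) `^ b).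
  exact: (measurableT_comp (measurable_powR b) mneg).
have mphi : measurable_fun setT (fun w => pospart (theta xi w) / (1 + x)
    - ln (1 + pospart (theta xi w) / (1 + x))).
  apply: measurable_funB; first exact: measurable_funM.
  apply: (measurableT_comp (@measurable_ln R)).
  by apply: measurable_funD => //; exact: measurable_funM.
have t0 w : 0 <= pospart (theta xi w) / (1 + x) by rewrite divr_ge0 ?pospart_ge0// ltW.
have phi0 w := log_defect_ge0 _ (t0 w).
have up := log_defect_upper (P x) (fun w => pospart (theta xi w)) alpha y0 (1 + x) mpos
  (fun w => pospart_ge0 _) a1 a2 y00 X0 (c + eta) _ (fun y h => proj2 (andP (tail x Xx x1x y h))).
have {}up := up (ltW (addr_gt0 c0 eta0)).
have lo := log_defect_lower (P x) (fun w => pospart (theta xi w)) alpha y0 (1 + x) mpos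
  (fun w => pospart_ge0 _) a1 a2 y00 X0 (c - eta) _ (fun y h => proj1 (andP (tail x Xx x1x y h))).
have ceta : 0 <= c - eta by lra.
have {}lo := lo ceta.
have phi0' : (0 <= \int[P x]_w (pospart (theta xi w) / (1 + x)
    - ln (1 + pospart (theta xi w) / (1 + x)))%:E)%E.
  by apply: integral_ge0 => w _; rewrite lee_fin.
have efin : (\int[P x]_w (pospart (theta xi w) / (1 + x)
    - ln (1 + pospart (theta xi w) / (1 + x)))%:E)%E \is a fin_num.
  by rewrite ge0_fin_numE//; apply: le_lt_trans up (ltry _).
set e := fine (\int[P x]_w (pospart (theta xi w) / (1 + x)
    - ln (1 + pospart (theta xi w) / (1 + x)))%:E)%E.
have Ee : (\int[P x]_w (pospart (theta xi w) / (1 + x)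
    - ln (1 + pospart (theta xi w) / (1 + x)))%:E)%E = e%:E by rewrite fineK.
(* The mean of theta_+ is finite because the expected defect is: ln (1 + t) <= (1 + t) / 2 yields t
   <= 1 + 2 (t - ln (1 + t)). *)
have [|w||p [Ep _ _]] := @integral_le_affine _ _ _ (P x) (fun w => pospart (theta xi w))
  _ (1 + x) (2 * (1 + x)) e (ltW X0) _ mpos mphi (fun w => pospart_ge0 _) phi0.
- by lra.
- have h := t0 w; set t := _ / _ in h *.
  have -> : pospart (theta xi w) = (1 + x) * t by rewrite /t; field; rewrite gt_eqF.
  have h2 : ln (1 + t) <= (1 + t) / 2.
    have -> : 1 + t = (1 + (t - 1) / 2) * (1 + 1) by field.
    rewrite lnM ?posrE; [|lra|lra].
    have l1 : ln (1 + (t - 1) / 2) <= (t - 1) / 2 by apply: le_ln1Dx; lra.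
    have l2 : ln (1 + 1 : R) <= 1 by apply: le_ln1Dx; lra.
    lra.
  have h3 : (1 + x) * t <= (1 + x) * (1 + 2 * (t - ln (1 + t))).
    by rewrite ler_pM2l//; lra.
  lra.
- by rewrite Ee.
(* The moment of order [beta] controls the mean and the moment of order min(beta, 2), the cap 2
   being imposed by [powRN_defect_neg]. *)
have negle1 b : 1 <= b -> b <= beta -> forall w, negpart (theta xi w) `^ b <= 1 + 1 * negpart (theta xi w) `^ beta.
  move=> b1 bb w; have h := negpart_ge0 (theta xi w); set t := negpart _ in h *.
  have hb : 0 <= t `^ beta by exact: powR_ge0.
  have [tle|tgt] := leP t 1.
    apply: (@le_trans _ _ 1); last by lra.
    have e1 : (1 : R) `^ b = 1 by rewrite powR1.
    by rewrite -[leRHS]e1; apply: ge0_ler_powR; rewrite ?nnegrE//; lra.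
  by apply: (@le_trans _ _ (t `^ beta)); [apply: ler_powR => //; exact: ltW|lra].
have neg0 b w : 0 <= negpart (theta xi w) `^ b by exact: powR_ge0.
have b1 : 1 <= beta by lra.
have [m [Em _ _]] := @integral_le_affine _ _ _ (P x) (fun w => negpart (theta xi w) `^ 1)
  (fun w => negpart (theta xi w) `^ beta) 1 1 B ler01 ler01 (mpow 1) (mpow beta) (neg0 1) (neg0 beta)
  (negle1 1 (lexx _) b1) (HB x Xx x1x).
have m1 : 1 <= Num.min beta 2 by rewrite le_min b1 ler1n.
have m2 : Num.min beta 2 <= beta by rewrite ge_min lexx.
have [N [EN _ NB]] := @integral_le_affine _ _ _ (P x) (fun w => negpart (theta xi w) `^ Num.min beta 2)
  (fun w => negpart (theta xi w) `^ beta) 1 1 B ler01 ler01 (mpow _) (mpow beta) (neg0 _) (neg0 beta)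
  (negle1 _ m1 m2) (HB x Xx x1x).
exists p, m, e; split.
- split=> //; last by rewrite fine_ge0.
  by rewrite -Em; apply: eq_integral => w _; rewrite powRr1// negpart_ge0.
- by rewrite -lee_fin -Ee.
- by rewrite -lee_fin EFinD -Ee.
- by rewrite EN lee_fin; move: NB; rewrite mul1r.
Qed.
End tail_condition.

(** The hypotheses normalise the drift by powers of x, the Lyapunov functions by powers of 1 + x.
    The factor (1 + 1/x)^(alpha - 1) between them is at least 1 and tends to 1. *)
Lemma shifted_drift {R : realType} (x alpha D : R) : 0 < x ->
  D / (1 + x) =
  (1 + x) `^ (- alpha) * ((1 + x^-1) `^ (alpha - 1) * (x `^ (alpha - 1) * D)).
Proof.
move=> x0; have X0 : 0 < 1 + x by rewrite addr_gt0.
have -> : (1 + x^-1) `^ (alpha - 1) * (x `^ (alpha - 1) * D) = (1 + x) `^ (alpha - 1) * D.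
  rewrite mulrA -powRM ?addr_ge0 ?invr_ge0 ?(ltW x0)//; congr (_ `^ _ * _).
  by field; rewrite gt_eqF.
rewrite mulrA -powRD; last by rewrite (gt_eqF X0) implybT.
rewrite addrA addNr add0r powR_inv1 ?(ltW X0)//.
by rewrite mulrC.
Qed.

(** * From the asymptotics of the drift to the type of the chain *)

Section classification.
Context {R : realType} {d : measure_display} {Om : measurableType d}.
Context {X : set R} {P : R -> probability Om R} {xi : nat -> Om -> R}.
Hypothesis mX : measurable X.
Hypothesis X0 : forall x, X x -> 0 <= x.
Hypothesis chain : markov_chain X P xi.

Lemma positive_recurrent_of_drift (alpha gamma : R) : 1 < alpha < 2 -> gamma < alpha - 1 ->
  (limf_esup (fun x => \int[P x]_w ((`| theta xi w |) `^ alpha)%:E)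
                     (within X (@pinfty_nbhs R)) < +oo)%E ->
  (limf_esup (fun x => ((x `^ gamma)%:E * drift P xi x)%E)
                     (within X (@pinfty_nbhs R)) < 0)%E ->
  positive_recurrent X P xi.
Proof.
move=> /andP[a1 a2] ga /limf_esup_ltP[M1 [K' [K'oo HK']]] /limf_esup_ltP[M2 [s [s0 Hs]]].
have [K K0 HK] : exists2 K : R, 0 < K & forall x, X x -> M1 < x ->
    (\int[P x]_w ((`| theta xi w |) `^ alpha)%:E <= K%:E)%E.
  have [K KK] : exists K : R, (K' <= K%:E)%E.
    by case: K' K'oo {HK'} => [r _|//|_]; [exists r|exists 0; exact: leNye].
  exists (Num.max K 1); first by rewrite lt_max ltr01 orbT.
  move=> x Xx Mx; apply: le_trans (HK' x Xx Mx) _; apply: le_trans KK _.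
  by rewrite lee_fin le_max lexx.
have [eps eps0 se] : exists2 eps : R, 0 < eps & (s <= (- eps)%:E)%E.
  case: s s0 {Hs} => [r|//|_]; last by exists 1 => //; exact: leNye.
  by rewrite lte_fin => r0; exists (- r); rewrite ?oppr_gt0// opprK.
(* [power_drift] needs q >= 1, so a negative [gamma] is replaced by 0; for x > 1 and negative drift
   this preserves the bound by [- eps]. *)
pose g := Num.max gamma 0; pose q := 1 + g.
have g0 : 0 <= g by rewrite le_max lexx orbT.
have gg : gamma <= g by rewrite le_max lexx.
have ga' : g < alpha - 1 by rewrite gt_max ga subr_gt0.
have q1 : 1 <= q by rewrite lerDl.
have qa : q < alpha by rewrite -ltrBrDl.
have aq0 : 0 < alpha - q by rewrite subr_gt0.
(* This makes the error 4 x^(q - alpha) K at most eps / 2, so half of the decrease [eps] remains as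
   surplus. *)
have e0 : 0 < eps / (8 * K) by rewrite divr_gt0// mulr_gt0.
have [M3 M30 HM3] := powRN_small (alpha - q) (eps / (8 * K)) aq0 e0.
apply: (@positive_recurrent_criterion _ _ _ _ _ _ mX chain (fun y => `|y| `^ q)
  (Num.max (Num.max M1 M2) (Num.max M3 1)) (eps / 2)).
- by rewrite divr_gt0.
- by move=> y; exact: powR_ge0.
- by apply: (measurableT_comp (measurable_powR q)); exact: normr_measurable.
move=> x Xx; rewrite !gt_max => /andP[/andP[xM1 xM2] /andP[xM3 x1]].
have x0 : 0 < x :> R by exact: lt_trans ltr01 x1.
have mth := measurable_theta chain.
have mpos : measurable_fun setT (fun w => pospart (theta xi w)) by exact: measurable_pospart.
have mneg : measurable_fun setT (fun w => negpart (theta xi w)) by exact: measurable_negpart.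
have mabs : measurable_fun setT (fun w => `|theta xi w| `^ alpha).
  by apply: (measurableT_comp (measurable_powR alpha)); exact: measurableT_comp.
have abs1 (t : R) : `|t| <= 1 + 1 * `|t| `^ alpha.
  have h : 0 <= `|t| `^ alpha by exact: powR_ge0.
  have [tle|tgt] := leP `|t| 1; first lra.
  have : `|t| <= `|t| `^ alpha by apply: le1r_powR; exact: ltW.
  lra.
have p1 w : pospart (theta xi w) <= 1 + 1 * `|theta xi w| `^ alpha.
  by apply: le_trans (abs1 _); rewrite /pospart; case: ifP => // _; exact: ler_norm.
have n1 w : negpart (theta xi w) <= 1 + 1 * `|theta xi w| `^ alpha.
  apply: le_trans (abs1 _); rewrite /negpart; case: ifP => // _.
  by rewrite -normrN; exact: ler_norm.
have abs0 w : 0 <= `|theta xi w| `^ alpha by exact: powR_ge0.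
have [p [Ep _ _]] := @integral_le_affine _ _ _ (P x) _ _ 1 1 K ler01 ler01 mpos mabs
  (fun w => pospart_ge0 _) abs0 p1 (HK x Xx xM1).
have [m [Em _ _]] := @integral_le_affine _ _ _ (P x) _ _ 1 1 K ler01 ler01 mneg mabs
  (fun w => negpart_ge0 _) abs0 n1 (HK x Xx xM1).
have Dle : x `^ gamma * (p - m) <= - eps.
  have := le_trans (Hs x Xx xM2) se.
  by rewrite (drift_fin chain x p m Ep Em) -EFinM lee_fin.
have xg0 : 0 < x `^ gamma by rewrite powR_gt0.
have xgg : x `^ gamma <= x `^ g by apply: ler_powR => //; exact: ltW.
have D0 : p - m <= 0.
  by rewrite -(pmulr_rle0 _ xg0); apply: (le_trans Dle); rewrite oppr_le0 ltW.
have Dle' : x `^ g * (p - m) <= - eps.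
  by apply: le_trans Dle; rewrite ler_wnM2r.
have main := power_drift mX X0 chain x q alpha p m K Xx x0 q1 qa a2 Ep Em (HK x Xx xM1).
rewrite (gtr0_norm x0).
have hq : q - 1 = g by rewrite /q addrAC subrr add0r.
have small : x `^ (q - alpha) * K <= eps / 8.
  have := HM3 x xM3; rewrite opprB ler_pdivlMr ?mulr_gt0// => h.
  by rewrite ler_pdivlMr//; move: h; rewrite mulrCA mulrA [_ * 8]mulrC mulrA.
apply: (@le_trans _ _ ((x `^ q + q * x `^ (q - 1) * (p - m) + 4 * x `^ (q - alpha) * K)%:E + (eps / 2)%:E)%E).
  by rewrite leeD2r.
rewrite hq -EFinD lee_fin.
have h1 : (q - 1) * (x `^ g * (p - m)) <= 0.
  by rewrite mulr_ge0_le0 ?subr_ge0//; apply: (le_trans Dle'); rewrite oppr_le0 ltW.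
lra.
Qed.

(** With z = (1 + x)^-alpha and positive drift, the drift term is at most z (l + G / 2) and the
    defect at least z (c1 L - G / 2). The bounds coincide because G = c1 L - l. *)
Lemma recurrent_of_drift (alpha beta c : R) : condN X P xi -> condT X P xi alpha beta c ->
  (limf_esup (fun x => ((x `^ (alpha - 1))%:E * drift P xi x)%E)
                 (within X (@pinfty_nbhs R))
         < (c * pi / `| sin (pi * alpha) |)%:E)%E -> recurrent X P xi.
Proof.
move=> hN hT /limf_esup_ltP[M [s [sL Hs]]].
have [/andP[a1 a2] ab c0 _] := hT.
set L := pi / `|sin (pi * alpha)|.
have L0 : 0 < L.
  have := csc_norm alpha a1 a2; rewrite -/L => <-; rewrite divr_gt0 ?pi_gt0//.
  apply: sin_gt0_pi; rewrite mulr_gt0 ?subr_gt0 ?pi_gt0//=.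
  by rewrite gtr_pMr ?pi_gt0//; lra.
rewrite -mulrA -/L in sL.
(* Taking [l] nonnegative makes [c1] positive and lets l be multiplied by upper bounds. *)
have [l [l0 lL sl]] : exists l : R, [/\ 0 <= l, l < c * L & (s <= l%:E)%E].
  have cL : 0 < c * L by rewrite mulr_gt0.
  case: s sL {Hs} => [r|//|_]; last by exists 0; split => //; exact: leNye.
  rewrite lte_fin => rL; exists (Num.max r 0); split; first by rewrite le_max lexx orbT.
    by rewrite gt_max rL.
  by rewrite lee_fin le_max lexx.
(* The midpoint between l / L and c: still above the drift threshold, yet below the tail constant by
   [eta]. *)
pose c1 := (l / L + c) / 2; pose eta := c - c1.
have lLc : l / L < c by rewrite ltr_pdivrMr.
have lL0 : 0 <= l / L by rewrite divr_ge0// ltW.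
have c10 : 0 < c1 by rewrite /c1; lra.
have eta0 : 0 < eta < c by rewrite /eta /c1; apply/andP; split; lra.
have c1E : c - eta = c1 by rewrite /eta; ring.
have c1L : c1 * L = (l + c * L) / 2 by rewrite /c1; field; rewrite gt_eqF.
pose G := c1 * L - l; have G0 : 0 < G by rewrite /G c1L; lra.
have [x1 [y0 [B [x10 y00 B0 Hm]]]] := condT_moments chain alpha beta c eta hT eta0.
have a20 : 0 < 2 - alpha by rewrite subr_gt0.
have ya0 : 0 < y0 `^ (2 - alpha) by rewrite powR_gt0.
(* Solves c1 y0^(2 - alpha) e1 / (2 - alpha) = G / 2, the share of the gap left to the error of
   [log_defect_lower]. *)
pose e1 := G * (2 - alpha) / (2 * c1 * y0 `^ (2 - alpha)).
have e10 : 0 < e1.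
  apply: divr_gt0; first exact: mulr_gt0.
  by apply: mulr_gt0 => //; apply: mulr_gt0.
have [M4 M40 HM4] := powRN_small (2 - alpha) e1 a20 e10.
(* The entry [2 * l / G] gives l / x <= G / 2, which absorbs the factor (1 + 1/x)^(alpha - 1). *)
pose a := Num.max (Num.max x1 M) (Num.max (Num.max M4 1) (2 * l / G)).
apply: (@recurrent_criterion _ _ _ _ _ _ mX chain (fun y => ln (1 + `|y|)) a).
- by rewrite /a !le_max x10.
- exact: hN.
- by move=> y; apply: ln_ge0; rewrite lerDl.
- apply: (measurableT_comp (@measurable_ln R)); apply: measurable_funD; first exact: measurable_cst.
  exact: (@normr_measurable R setT).
- move=> y z y_ge0 yz; have z_ge0 := le_trans y_ge0 yz.
  by rewrite !ger0_norm// ler_ln ?posrE ?lerD2l// ltr_pwDl.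
- move=> M'; exists (expR M'); first exact: expR_ge0.
  rewrite ger0_norm ?expR_ge0// -[ltLHS](expRK M').
  rewrite ltr_ln ?posrE ?expR_gt0 ?addr_gt0 ?expR_gt0//.
  by rewrite ltrDr.
move=> x Xx; rewrite /a !gt_max => /andP[/andP[xx1 xM] /andP[/andP[xM4 x1'] xl]].
have x0 : 0 < x :> R by exact: lt_trans ltr01 x1'.
have [p [m [e [[Ep Em Ee e_ge0] _ lo _]]]] := Hm x Xx (ltW xx1) (ltW x0).
have := log_drift mX X0 chain x p m e Xx Ep Em Ee.
rewrite [`|x|]gtr0_norm// => /le_trans; apply; rewrite lee_fin.
rewrite -[leRHS]addr0 -addrA lerD2l subr_le0.
(* For nonpositive drift the nonnegative defect suffices; positivity is used below to multiply upper
   bounds. *)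
have [D0|D0] := leP (p - m) 0.
  apply: le_trans e_ge0; rewrite mulr_le0_ge0// invr_ge0 addr_ge0//; exact: ltW.
have Dle : x `^ (alpha - 1) * (p - m) <= l.
  have := le_trans (Hs x Xx xM) sl.
  by rewrite (drift_fin chain x p m Ep Em) -EFinM lee_fin.
rewrite (shifted_drift x alpha (p - m) x0).
move: lo; rewrite c1E -/L; set z := (1 + x) `^ (- alpha) => lo.
have z0 : 0 <= z by exact: powR_ge0.
have r : c1 * ((y0 / (1 + x)) `^ (2 - alpha) / (2 - alpha)) <= G / 2.
  have Xx0 : 0 < 1 + x by rewrite addr_gt0.
  have : (1 + x) `^ (- (2 - alpha)) <= e1 by apply: HM4; apply: (lt_trans xM4); rewrite ltrDr.
  rewrite powRM ?(ltW y00) ?invr_ge0 ?(ltW Xx0)// -powR_inv1 ?(ltW Xx0)// -powRrM mulN1r => h.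
  apply: (@le_trans _ _ (c1 * (y0 `^ (2 - alpha) * e1 / (2 - alpha)))).
    by rewrite ler_pM2l// ler_pM2r ?invr_gt0// ler_pM2l.
  by rewrite le_eqVlt; apply/orP; left; apply/eqP; rewrite /e1; field; rewrite !gt_eqF.
have k1 : (1 + x^-1) `^ (alpha - 1) <= 1 + x^-1.
  by apply: ler1_powR; [rewrite lerDl invr_ge0 ltW|lra].
have xil : x^-1 * l <= G / 2.
  by rewrite mulrC ler_pdivrMr//; move: xl; rewrite ltr_pdivrMr//; lra.
have k2 : (1 + x^-1) `^ (alpha - 1) * (x `^ (alpha - 1) * (p - m)) <= (1 + x^-1) * l.
  apply: ler_pM => //; first exact: powR_ge0.
  by rewrite mulr_ge0 ?powR_ge0// ltW.
have k3 : z * ((1 + x^-1) `^ (alpha - 1) * (x `^ (alpha - 1) * (p - m))) <= z * (l + G / 2).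
  by apply: ler_wpM2l => //; apply: (le_trans k2); lra.
have k4 : z * (c1 * ((y0 / (1 + x)) `^ (2 - alpha) / (2 - alpha))) <= z * (G / 2).
  exact: ler_wpM2l.
have GE : z * G = z * (c1 * L) - z * l by rewrite /G mulrBr.
lra.
Qed.

(** In units of nu (1 + x)^-(nu + alpha) the drift gains at least l, which exceeds the leading cost
    (c + eta) L by G. A quarter of G pays for the tail below [y0], half for the factor 1 + nu, a
    quarter for the downward jumps. *)
Lemma transient_of_drift (alpha beta c : R) : condN X P xi -> condT X P xi alpha beta c ->
  ((c * pi / `| sin (pi * alpha) |)%:E
         < limf_einf (fun x => ((x `^ (alpha - 1))%:E * drift P xi x)%E)
                     (within X (@pinfty_nbhs R)))%E -> transient X P xi.
Proof.
move=> hN hT; rewrite /limf_einf lteNr => /limf_esup_ltP[M [s [sL Hs]]].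
have [/andP[a1 a2] ab c0 _] := hT.
move: sL; rewrite -mulrA; set L := pi / `|sin (pi * alpha)|; rewrite -EFinN => sL.
have L0 : 0 < L.
  have := csc_norm alpha a1 a2; rewrite -/L => <-; rewrite divr_gt0 ?pi_gt0//.
  apply: sin_gt0_pi; rewrite mulr_gt0 ?subr_gt0 ?pi_gt0//=.
  by rewrite gtr_pMr ?pi_gt0//; lra.
have cL : 0 < c * L by rewrite mulr_gt0.
have [l lL sl] : exists2 l : R, c * L < l & (s <= (- l)%:E)%E.
  case: s sL {Hs} => [r|//|_]; last by exists (c * L + 1); [lra|exact: leNye].
  by rewrite lte_fin => rL; exists (- r); [lra|rewrite opprK].
(* The first entry keeps (c + eta) L below the midpoint of c L and l, the second keeps [eta] below
   [c] as [condT_moments] demands. *)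
pose eta := Num.min ((l / L - c) / 2) (c / 2).
have lLc : c < l / L by rewrite ltr_pdivlMr.
have eta0 : 0 < eta by rewrite lt_min; apply/andP; split; lra.
have eta1 : eta <= (l / L - c) / 2 by rewrite ge_min lexx.
have eta2 : eta <= c / 2 by rewrite ge_min lexx orbT.
have etac : 0 < eta < c by rewrite eta0; lra.
have c2L : (c + eta) * L <= (c * L + l) / 2.
  apply: (@le_trans _ _ ((c + (l / L - c) / 2) * L)); first by rewrite ler_pM2r// lerD2l.
  by rewrite le_eqVlt; apply/orP; left; apply/eqP; field; rewrite gt_eqF.
have c2L0 : 0 < (c + eta) * L by rewrite mulr_gt0// addr_gt0.
pose G := l - (c + eta) * L; have G0 : 0 < G by rewrite /G; lra.
have [x1 [y0 [B [x10 y00 B0 Hm]]]] := condT_moments chain alpha beta c eta hT etac.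
pose b := Num.min beta 2.
have ba : alpha < b by rewrite lt_min ab.
have b2 : b <= 2 by rewrite ge_min lexx orbT.
have b02 : 0 < b <= 2 by rewrite b2 andbT; lra.
(* The three entries serve Bernoulli's inequality, the negligibility of x^(nu - b) against x^-alpha,
   and nu (c + eta) L <= G / 2. *)
pose nu := Num.min 1 (Num.min ((b - alpha) / 2) (G / (2 * ((c + eta) * L)))).
have nu0 : 0 < nu.
  have n1 : 0 < (b - alpha) / 2 by rewrite divr_gt0 ?subr_gt0.
  have n2 : 0 < G / (2 * ((c + eta) * L)) by apply: divr_gt0 => //; apply: mulr_gt0.
  by rewrite !lt_min ltr01 n1 n2.
have nu1 : nu <= 1 by rewrite ge_min lexx.
have nu01 : 0 < nu <= 1 by rewrite nu0.
have nub : nu <= (b - alpha) / 2 by rewrite !ge_min lexx orbT.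
have nuG : nu * ((c + eta) * L) <= G / 2.
  have : nu <= G / (2 * ((c + eta) * L)) by rewrite !ge_min lexx !orbT.
  have c2L2 : 0 < 2 * ((c + eta) * L) by apply: mulr_gt0.
  by rewrite ler_pdivlMr//; lra.
pose N := 1 + B; have N0 : 0 < N by rewrite /N ltr_pwDl.
have s10 : 0 < 2 - alpha by rewrite subr_gt0.
have s20 : 0 < b - alpha - nu by lra.
have y20 : 0 < y0 `^ 2 by rewrite powR_gt0.
(* These two tolerances yield exactly G / 4 after multiplication by y0^2 and nu G / 4 after
   multiplication by 4 N. *)
have e10 : 0 < G / (4 * y0 `^ 2) by apply: divr_gt0 => //; apply: mulr_gt0.
have e20 : 0 < nu * G / (16 * N) by apply: divr_gt0; apply: mulr_gt0.
have [M3 M30 HM3] := powRN_small (2 - alpha) _ s10 e10.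
have [M4 M40 HM4] := powRN_small (b - alpha - nu) _ s20 e20.
pose a := Num.max (Num.max x1 M) (Num.max (Num.max M3 M4) 1).
apply: (@transient_criterion _ _ _ _ _ _ mX X0 chain (fun y => (1 + `|y|) `^ (- nu)) a).
- exact: hN.
- by move=> y; exact: powR_ge0.
- apply: (measurableT_comp (measurable_powR (- nu))); apply: measurable_funD; first exact: measurable_cst.
  exact: (@normr_measurable R setT).
- by move=> y y_ge0; rewrite powR_gt0// ltr_pwDl.
- move=> y z y_ge0 yz; have z_ge0 := le_trans y_ge0 yz.
  rewrite !ger0_norm// !powRN lef_pV2 ?posrE ?powR_gt0 ?ltr_pwDl//.
  by apply: ge0_ler_powR; rewrite ?nnegrE ?addr_ge0 ?lerD2l// ltW.
- move=> e e_gt0; have e2 : 0 < e / 2 by rewrite divr_gt0.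
  have [M' M'0 HM'] := powRN_small nu (e / 2) nu0 e2.
  exists M'; first exact: ltW.
  rewrite gtr0_norm//; apply: (@le_lt_trans _ _ (e / 2)); last by lra.
  by apply: HM'; rewrite ltrDr.
move=> x Xx; rewrite /a !gt_max => /andP[/andP[xx1 xM] /andP[/andP[xM3 xM4] x1']].
have x0 : 0 < x :> R by exact: lt_trans ltr01 x1'.
have Xx0 : 0 < 1 + x by rewrite addr_gt0.
have [p [m [e [[Ep Em Ee e_ge0] up _ EN]]]] := Hm x Xx (ltW xx1) (ltW x0).
have Ee' : (\int[P x]_w (pospart (theta xi w) / (1 + x)
    - ln (1 + pospart (theta xi w) / (1 + x)))%:E <= e%:E)%E by rewrite Ee.
have := negpow_drift mX X0 chain x nu b p m e N Xx nu01 b02 Ep Em Ee' EN.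
rewrite [`|x|]gtr0_norm// => /le_trans; apply; rewrite lee_fin.
rewrite -[leRHS]mulr1; apply: ler_wpM2l; first exact: powR_ge0.
have Dge : l <= x `^ (alpha - 1) * (p - m).
  have := le_trans (Hs x Xx xM) sl.
  by rewrite (drift_fin chain x p m Ep Em) -EFinM -EFinN lee_fin lerN2.
rewrite (shifted_drift x alpha (p - m) x0).
move: up; rewrite -/L; set z := (1 + x) `^ (- alpha) => up.
have z0 : 0 <= z by exact: powR_ge0.
have k1 : 1 <= (1 + x^-1) `^ (alpha - 1).
  rewrite -[leLHS](powRr0 (1 + x^-1)); apply: ler_powR; last by lra.
  by rewrite lerDl invr_ge0 ltW.
have k2 : l <= (1 + x^-1) `^ (alpha - 1) * (x `^ (alpha - 1) * (p - m)).
  by apply: (le_trans Dge); apply: ler_peMl => //; lra.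
have k3 : z * l <= z * ((1 + x^-1) `^ (alpha - 1) * (x `^ (alpha - 1) * (p - m))).
  exact: ler_wpM2l.
set Z := z * (_ * _) in k3 *.
have k4 : (y0 / (1 + x)) `^ 2 <= z * (G / 4).
  have h : (1 + x) `^ (- (2 - alpha)) <= G / (4 * y0 `^ 2).
    by apply: HM3; apply: (lt_trans xM3); rewrite ltrDr.
  have -> : (y0 / (1 + x)) `^ 2 = z * (y0 `^ 2 * (1 + x) `^ (- (2 - alpha))).
    rewrite powRM ?(ltW y00) ?invr_ge0 ?(ltW Xx0)// -powR_inv1 ?(ltW Xx0)// -powRrM mulN1r.
    rewrite /z mulrCA -powRD; last by rewrite (gt_eqF Xx0) implybT.
    by congr (_ * _ `^ _); ring.
  apply: ler_wpM2l => //.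
  have := ler_wpM2l (ltW y20) h.
  have -> : y0 `^ 2 * (G / (4 * y0 `^ 2)) = G / 4 by field; rewrite gt_eqF.
  by [].
have k5 : 4 * (1 + x) `^ (nu - b) * N <= z * (nu * G / 4).
  have h : (1 + x) `^ (- (b - alpha - nu)) <= nu * G / (16 * N).
    by apply: HM4; apply: (lt_trans xM4); rewrite ltrDr.
  have -> : 4 * (1 + x) `^ (nu - b) * N = z * (4 * N * (1 + x) `^ (- (b - alpha - nu))).
    rewrite /z mulrCA -powRD; last by rewrite (gt_eqF Xx0) implybT.
    by rewrite (_ : - alpha + - (b - alpha - nu) = nu - b); ring.
  apply: ler_wpM2l => //.
  have N40 : 0 <= 4 * N by rewrite mulr_ge0// ltW.
  have := ler_wpM2l N40 h.
  have -> : 4 * N * (nu * G / (16 * N)) = nu * G / 4 by field; rewrite gt_eqF.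
  by [].
(* As nu <= 1, the factor 1 + nu is absorbed by the 1 / 2 in front of the square; on the main term
   it costs at most z G / 2 by the choice of [nu]. *)
have k6 : (1 + nu) * e <= z * (G / 4) + z * ((c + eta) * L + G / 2).
  have q1 : (1 + nu) * e <= (1 + nu) * ((y0 / (1 + x)) `^ 2 / 2 + (c + eta) * z * L).
    by apply: ler_wpM2l => //; rewrite addr_ge0// ltW.
  have q2 : nu * ((y0 / (1 + x)) `^ 2 / 2) <= 1 * ((y0 / (1 + x)) `^ 2 / 2).
    by apply: ler_wpM2r => //; rewrite divr_ge0// powR_ge0.
  have q3 : z * (nu * ((c + eta) * L)) <= z * (G / 2) by exact: ler_wpM2l.
  lra.
have k7 : nu * ((1 + nu) * e) <= nu * (z * (G / 4) + z * ((c + eta) * L + G / 2)).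
  by apply: ler_wpM2l => //; exact: ltW.
have k8 : nu * (z * l) <= nu * Z by apply: ler_wpM2l => //; exact: ltW.
have GE : nu * (z * G) = nu * (z * l) - nu * (z * ((c + eta) * L)).
  by rewrite /G; ring.
lra.
Qed.
End classification.

Theorem theorem2p1 (R : realType) (d : measure_display) (Om : measurableType d)
  (X : set R) (P : R -> probability Om R) (xi : nat -> Om -> R) :
  measurable X -> (forall x, X x -> 0 <= x) ->
  (forall M : R, exists x, X x /\ M < x) ->
  markov_chain X P xi ->
  (* (i) *)
  (forall alpha beta c : R,
     condN X P xi -> condT X P xi alpha beta c ->
     ((limf_esup (fun x => ((x `^ (alpha - 1))%:E * drift P xi x)%E)
                 (within X (@pinfty_nbhs R))
         < (c * pi / `| sin (pi * alpha) |)%:E)%E -> recurrent X P xi)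
     /\
     (((c * pi / `| sin (pi * alpha) |)%:E
         < limf_einf (fun x => ((x `^ (alpha - 1))%:E * drift P xi x)%E)
                     (within X (@pinfty_nbhs R)))%E -> transient X P xi))
  /\
  (* (ii) *)
  ((exists alpha gamma : R,
      [/\ 1 < alpha < 2, gamma < alpha - 1,
          (limf_esup (fun x => \int[P x]_w ((`| theta xi w |) `^ alpha)%:E)
                     (within X (@pinfty_nbhs R)) < +oo)%E &
          (limf_esup (fun x => ((x `^ gamma)%:E * drift P xi x)%E)
                     (within X (@pinfty_nbhs R)) < 0)%E])
   -> positive_recurrent X P xi).
Proof.
move=> mX X0 _ chain; split=> [alpha beta c hN hT|[alpha [gamma [a12 ga hK hmu]]]].
- split; first exact: (recurrent_of_drift mX X0 chain alpha beta c hN hT).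
  exact: (transient_of_drift mX X0 chain alpha beta c hN hT).
- exact: (positive_recurrent_of_drift mX X0 chain alpha gamma a12 ga hK hmu).
Qed.
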